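(* Let $d\ge 2$ and suppose that balls, annuli and the sets $E_\mu(\delta,\eta)$ are defined with the norm $\|x\|_\infty=\max\{|x_i|: i=1,\dots,d\}$ on $\mathbb{R}^d$. For all real numbers $\underline{d},\overline{d}$ with $0\le \underline{d}\le d-1$ and $\underline{d}\le\overline{d}\le d$, every $\eta\in(0,1)$ and every $\delta>1$, there exists a (Radon) probability measure $\mu$ on $\mathbb{R}^{d}$ such that $\underline{\dim}(\mu) = \underline{d}$, $\overline{\dim}(\mu) =\overline{d}$ and $\mu\big(E_\mu(\delta,\eta)\big) =1$.
   Context: For the norm $\|\cdot\|=\|\cdot\|_\infty$, $B(x,r)=\{y\in\mathbb{R}^d:\|x-y\|\le r\}$ is the closed ball. For $x\in \mathbb{R}^d$, $0<r<1$ and $\delta \geq 1$, the annulus is $A(x,r,\delta) = B (x,r)\setminus B (x,r-r^\delta)$. One says that $P_{\mu}(x,r,\delta,\eta)$ holds when $\mu(A (x,r,\delta)) \geq \eta\, \mu(B(x,r))$. One sets $E_{\mu}(\delta,\eta) = \{x\in \mathbb{R}^d: P_{\mu}(x,r_n,\delta,\eta)$ holds for every $n$, for some sequence of radii $(r_n)_{n\geq 1}$ tending to $0\}$. The lower and upper dimensions of $\mu$ are $\underline{\dim}(\mu)= \sup \{\alpha\geq 0: \text{ for } \mu\text{-a.e. } x,\ \exists\, r_x>0,\ \forall\, 0<r<r_x,\ \mu(B(x,r)) \leq r^\alpha\}$ and $\overline{\dim}(\mu)= \inf \{\beta\geq 0: \text{ for } \mu\text{-a.e. } x,\ \exists\,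 r_x>0,\ \forall\, 0<r<r_x,\ \mu(B(x,r)) \geq r^\beta\}$. *)

(* Defs.v *)
From HB Require Import structures.
From mathcomp Require Import all_boot all_order all_algebra.
From mathcomp Require Import all_classical all_reals all_analysis.
Set Implicit Arguments.
Unset Strict Implicit.
Unset Printing Implicit Defensive.
Import Order.TTheory GRing.Theory Num.Theory numFieldNormedType.Exports.
Local Open Scope classical_set_scope.
Local Open Scope ring_scope.

(* R^d with its Borel sigma-algebra. The library norm on 'rV[R]_d is the sup
   norm, and its topology is the usual one. *)
Definition borel_rV (R : realType) (d : nat) :=
  g_sigma_algebraType (@open 'rV[R]_d).

Section annuli.
Context (R : realType) (d : nat).
Implicit Types (x : 'rV[R]_d) (r delta eta : R).

(* [closed_ball_] rather than [closed_ball]: the latter is the closure of the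
   open ball, hence empty for radius 0, which occurs below when delta = 1. *)
Definition cball x r : set 'rV[R]_d := closed_ball_ (fun y => `|y|) x r.

Definition annulus x r delta : set 'rV[R]_d :=
  cball x r `\` cball x (r - r `^ delta).

Variable mu : {measure set (borel_rV R d) -> \bar R}.

Definition annulus_charged x r delta eta : Prop :=
  (eta%:E * mu (cball x r) <= mu (annulus x r delta))%E.

Definition Eset delta eta : set (borel_rV R d) :=
  [set x | exists r_ : R^nat,
    [/\ forall n, 0 < r_ n < 1,
        r_ @ \oo --> 0 &
        forall n, annulus_charged x (r_ n) delta eta]].

Definition lower_dim : \bar R :=
  ereal_sup [set alpha%:E | alpha in [set alpha : R | 0 <= alpha /\
    {ae mu, forall x, exists2 rx : R, 0 < rx &
      forall r, 0 < r < rx -> (mu (cball x r) <= (r `^ alpha)%:E)%E}]].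

Definition upper_dim : \bar R :=
  ereal_inf [set beta%:E | beta in [set beta : R | 0 <= beta /\
    {ae mu, forall x, exists2 rx : R, 0 < rx &
      forall r, 0 < r < rx -> ((r `^ beta)%:E <= mu (cball x r))%E}]].

Definition radon : Prop :=
  (forall K : set 'rV[R]_d, compact K -> (mu K < +oo)%E) /\
  (forall A : set (borel_rV R d), measurable A ->
    mu A = ereal_sup
      [set mu K | K in [set K : set 'rV[R]_d | compact K /\ K `<=` A]]).

End annuli.

(* Main.v *)
From HB Require Import structures.
Require Import Defs.
From mathcomp Require Import all_boot all_order all_algebra.
From mathcomp Require Import all_classical all_reals all_analysis.
From mathcomp Require Import measurable_realfun.
From mathcomp Require Import zify ring lra.
Set Implicit Arguments.
Unset Strict Implicit.
Unset Printing Implicit Defensive.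
Import Order.TTheory GRing.Theory Num.Theory numFieldNormedType.Exports.
Local Open Scope classical_set_scope.
Local Open Scope ring_scope.

(** The measure is the law of a random point whose coordinates are written in base
    2 with independent digits of three kinds: fair digits, idle digits, always 0,
    and slab digits, which are 0 with probability [2 ^- k].

    At each level the number of fair digits among the d coordinates can be chosen
    freely between 0 and d. Balls of radius [2 ^- n] have measure [2 ^- J n], up to
    a bounded factor and a factor [2 ^- (k * s n)], where [J n] and [s n] are the
    numbers of fair and slab digits of level below n ([ball_measure_le],
    [ball_measure_ge]). If [s n] is negligible, the dimensions are the lower and
    upper limits of [J n / n] ([lower_dimE], [upper_dimE]). The slope of J is
    [dlow] or [dup] in alternate phases, whose lengths grow so fast that [J n / n]
    comes close to the slope at the end of each phase
    ([fair_total_eventually_ge], [fair_slab_total_eventually_le],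
    [fair_slab_total_often_le], [fair_total_often_ge]).

    As [dlow <= d - 1], coordinate 0 needs no fair digit in a phase of slope [dlow].
    At the beginning of such a phase it receives a single slab digit, at level j,
    and nothing more until the end n of the phase. At scales between [2 ^- n] and
    [2 ^- j] the measure then lives on pairs of slabs orthogonal to the first axis, at
    distance [2 ^- j.+1] and of thickness [2 ^- n], which is less than any given
    power of the distance. Seen from a point of the light slab of a pair, the heavy
    slab lies in a thin annulus; by independence of the coordinates it carries a
    fraction [1 - 2 ^- k >= eta] of the ball ([slab_annulus_charged]). A given
    point is in the light slab with probability [2 ^- k] only, but this happens
    independently in infinitely many phases, hence almost surely infinitely often
    ([light_slab_infinitely_often]). This is why the light slab may have
    an arbitrarily small weight, as eta close to 1 requires.

    All the probability theory needed is that of the digits in base [2 ^ k] of a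
    uniform real number ([symbol_independent]). The measure is Radon as is every
    finite Borel measure on the space ([radon_probability]). *)

(** * Independent digits from Lebesgue measure *)

Section digits.
Context {R : realType}.
Notation leb := (@lebesgue_measure R).

Lemma lebesgue_measure_translate (c : R) (A : set (measurableTypeR R)) :
  measurable A -> leb ((fun x => x + c) @^-1` A) = leb A.
Proof.
move=> mA.
have mT : measurable_fun setT ((fun x : measurableTypeR R => x + c) : _ -> measurableTypeR R).
  by apply: measurable_funD => //; exact: measurable_cst.
suff : leb A = pushforward leb ((fun x => x + c) : _ -> measurableTypeR R) A by [].
apply: lebesgue_measure_unique => // _ [[a b]] _ <-.
transitivity (leb ((fun x : R => x + c) @^-1` `]a, b])); last by [].
rewrite (_ : _ @^-1` _ = `]a - c, b - c]%classic); last first.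
  by apply/seteqP; split => x /=; rewrite !in_itv/= ltrBlDr lerBrDr.
rewrite !lebesgue_measure_itv/= !lte_fin ltrD2r.
by case: ifP => // _; rewrite -!EFinB; congr (_%:E); ring.
Qed.

Definition unif01 : set (measurableTypeR R) -> \bar R :=
  mrestr leb (@measurable_itv _ `[0, 1[).

HB.instance Definition _ := Measure.on unif01.

Let unif01_setT : unif01 setT = 1%E.
Proof.
by rewrite /unif01 /mrestr setTI lebesgue_measure_itv/= lte_fin ltr01 sube0.
Qed.

HB.instance Definition _ := Measure_isProbability.Build _ _ _ unif01 unif01_setT.

Variable M : nat.
Hypothesis M_gt0 : (0 < M)%N.

Definition scaled_floor (m : nat) (u : R) : nat := Num.truncn (M%:R ^+ m * u).
Definition symbol (m : nat) (u : R) : nat := (scaled_floor m.+1 u %% M)%N.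

Let MR_gt0 m : 0 < M%:R ^+ m :> R.
Proof. by rewrite exprn_gt0// ltr0n. Qed.

(* Two real numbers that differ by an integer have integer parts that differ by
   that integer; stated without subtraction on [nat]. *)
Let floor_shift (x : R) (p q r s : nat) : p%:R <= x < p.+1%:R ->
  q%:R <= x + (s%:R - r%:R) < q.+1%:R -> (q + r = p + s)%N.
Proof.
rewrite -!(natr1 p) -!(natr1 q) => /andP[p1 p2] /andP[q1 q2].
have h1 : (q + r < (p + s).+1)%N by rewrite -(ltr_nat R) -natr1 !natrD; lra.
have h2 : (p + s < (q + r).+1)%N by rewrite -(ltr_nat R) -natr1 !natrD; lra.
by apply/eqP; rewrite eqn_leq -ltnS h1 -ltnS h2.
Qed.

Lemma scaled_floor_div (j n : nat) (u : R) : 0 <= u ->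
  (scaled_floor (j + n) u %/ M ^ n)%N = scaled_floor j u.
Proof.
move=> u0; have x0 : 0 <= M%:R ^+ j * u by rewrite mulr_ge0// ltW.
have y0 : 0 <= M%:R ^+ (j + n) * u by rewrite mulr_ge0// ltW.
have Mn : (0 < M ^ n)%N by rewrite expn_gt0 M_gt0.
apply/esym/eqP; rewrite truncn_eq//.
have /andP[h1 h2] := truncn_itv y0.
set K := Num.truncn _ in h1 h2.
have e : M%:R ^+ (j + n) * u = (M ^ n)%:R * (M%:R ^+ j * u).
  by rewrite exprD natrX; ring.
rewrite e in h1 h2.
apply/andP; split.
- rewrite -(@ler_pM2l _ (M ^ n)%:R) ?ltr0n// (le_trans _ h1)// -natrM ler_nat.
  by rewrite mulnC leq_trunc_div.
- rewrite -(@ltr_pM2l _ (M ^ n)%:R) ?ltr0n// (lt_le_trans h2)// -natrM ler_nat.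
  by rewrite mulnC ltn_ceil.
Qed.

(** Adding [(b - a) / M ^ m.+1] changes the m-th symbol from a to b and creates no
    carry, so that all other symbols are kept. *)
Lemma symbol_translate (m : nat) (a b : nat) (u : R) : (a < M)%N -> (b < M)%N ->
  0 <= u < 1 -> symbol m u = a ->
  let v := u + (b%:R - a%:R) / M%:R ^+ m.+1 in
  [/\ 0 <= v < 1, symbol m v = b & forall k, k != m -> symbol k v = symbol k u].
Proof.
move=> aM bM /andP[u0 u1] sua v.
have U0 j : 0 <= M%:R ^+ j * u by rewrite mulr_ge0// ltW.
have vE j : M%:R ^+ (m.+1 + j) * v =
    M%:R ^+ (m.+1 + j) * u + (b%:R - a%:R) * (M ^ j)%:R.
  by rewrite /v exprD natrX; field; apply: lt0r_neq0.
(* the integer part of [M ^ m.+1 * v] comes from that of [M ^ m.+1 * u] by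
   exchanging the last symbol *)
have Ku : (scaled_floor m.+1 u = scaled_floor m u * M + a)%N.
  rewrite (divn_eq (scaled_floor m.+1 u) M) -sua /symbol.
  by rewrite -(scaled_floor_div m 1 u0) expn1 addn1.
have /andP[h1 h2] := truncn_itv (U0 m.+1).
rewrite -/(scaled_floor m.+1 u) Ku in h1 h2.
have vm : M%:R ^+ m.+1 * v = M%:R ^+ m.+1 * u + (b%:R - a%:R).
  by have := vE 0%N; rewrite addn0 expn0 mulr1.
have Mv0 : 0 <= M%:R ^+ m.+1 * v.
  rewrite vm; move: h1; rewrite natrD natrM.
  have : 0 <= (scaled_floor m u)%:R * M%:R :> R by rewrite mulr_ge0// ler0n.
  have : 0 <= b%:R :> R by rewrite ler0n.
  lra.
have v0 : 0 <= v by move: Mv0; rewrite pmulr_rge0.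
have V0 j : 0 <= M%:R ^+ j * v by rewrite mulr_ge0// ltW.
have Kv : (scaled_floor m.+1 v = scaled_floor m u * M + b)%N.
  apply/eqP; rewrite truncn_eq// vm.
  move: h1 h2; rewrite -!natr1 !natrD; lra.
have Kvj j : (scaled_floor (m.+1 + j) v + a * M ^ j =
    scaled_floor (m.+1 + j) u + b * M ^ j)%N.
  apply: (@floor_shift (M%:R ^+ (m.+1 + j) * u)); first exact: truncn_itv.
  by have := truncn_itv (V0 (m.+1 + j)%N); rewrite -/(scaled_floor _ v) vE mulrBl !natrM.
have Klow : scaled_floor m v = scaled_floor m u.
  rewrite -(scaled_floor_div m 1 v0) addn1 Kv expn1.
  by rewrite divnMDl// divn_small// addn0.
have v1 : v < 1.
  have : scaled_floor 0 v = 0%N.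
    rewrite -(scaled_floor_div 0 m v0) add0n Klow -{1}(add0n m) scaled_floor_div//.
    by apply/eqP; rewrite truncn_eq ?expr0 ?mul1r//= u0 u1.
  by move/eqP; rewrite truncn_eq expr0 mul1r// => /andP[].
split; first by rewrite v0 v1.
- by rewrite /symbol Kv modnMDl modn_small.
- move=> k; rewrite neq_ltn => /orP[km|mk].
  + rewrite /symbol; congr (_ %% _)%N.
    by rewrite -(scaled_floor_div k.+1 (m - k.+1) v0) -(scaled_floor_div k.+1 (m - k.+1) u0) subnKC// Klow.
  + have kE : k.+1 = (m.+1 + (k - m.+1).+1)%N by lia.
    rewrite /symbol kE; have := congr1 (modn^~ M) (Kvj (k - m.+1).+1).
    by rewrite /= expnS !(mulnCA _ M) !(mulnC M) !(addnC (scaled_floor _ _)) !modnMDl.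
Qed.

Lemma measurable_symbol m a : measurable [set u : measurableTypeR R | symbol m u = a].
Proof.
have mf : measurable_fun setT ((fun u : measurableTypeR R => M%:R ^+ m.+1 * u) : _ -> measurableTypeR R).
  by apply: measurable_funM => //; exact: measurable_cst.
rewrite (_ : [set u | _] = \bigcup_(K in [set K | K %% M = a]%N)
    ((fun u : R => M%:R ^+ m.+1 * u) @^-1` [set x : R | Num.truncn x = K])).
  apply: bigcup_measurable => K _; rewrite -[X in measurable X]setTI; apply: mf => //.
  case: K => [|K].
    rewrite (_ : [set x | _] = `]-oo, 1[%classic) //; apply/seteqP; split => x /=.
      by move/truncn0Pn; rewrite in_itv/= -ltNge.
    by rewrite in_itv/= => x1; apply/truncn0Pn; rewrite -ltNge.
  rewrite (_ : [set x | _] = `[K.+1%:R, K.+2%:R[%classic) //; apply/seteqP; split => x /=.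
    move=> xK; have x0 : 0 <= x.
      by rewrite leNgt; apply/negP => x0; move: xK; rewrite (truncn0Pn _ _)// -ltNge (lt_trans x0).
    by rewrite in_itv/=; have := truncn_itv x0; rewrite xK.
  by rewrite in_itv/= => xK; apply: truncn_def.
apply/seteqP; split => u /=.
  by move=> <-; exists (Num.truncn (M%:R ^+ m.+1 * u)).
by move=> [K /= <- uK]; rewrite /symbol /scaled_floor uK.
Qed.

(** Exchanging the value of the m-th symbol is a translation, and Lebesgue measure
    is invariant under translations. By symmetry the inequality is an equality. *)
Lemma symbol_exchange m a b (E : set (measurableTypeR R)) : (a < M)%N -> (b < M)%N ->
  measurable E ->
  (forall u v, (forall k, k != m -> symbol k u = symbol k v) -> E u -> E v) ->
  (unif01 (E `&` [set u | symbol m u = a]) <=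
   unif01 (E `&` [set u | symbol m u = b]))%E.
Proof.
move=> aM bM mE Einv.
have mEa c : measurable (E `&` [set u | symbol m u = c] `&` `[0, 1[).
  by apply: measurableI => //; apply: measurableI => //; exact: measurable_symbol.
rewrite /unif01 /mrestr.
rewrite -(lebesgue_measure_translate ((b%:R - a%:R) / M%:R ^+ m.+1) (mEa b)).
apply: le_measure; rewrite ?inE//.
  rewrite -[X in measurable X]setTI.
  apply: (_ : measurable_fun setT ((fun x : measurableTypeR R => x + _) : _ -> measurableTypeR R)) => //.
  by apply: measurable_funD => //; exact: measurable_cst.
move=> u [[Eu /= ua]]; rewrite /= in_itv/= => u01.
have [v01 vb vk] := symbol_translate aM bM u01 ua.
split=> //; split => //; apply: Einv Eu => k km; exact/esym/vk.
Qed.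

(** Independence is stated for the events [E] that do not see the m-th symbol:
    this is the form in which every later computation uses it, and it spares
    the construction of an infinite product measure. It holds because the M
    events [symbol m u = b] cut such an [E] into translates of one another. *)
Lemma symbol_independent m (f : pred nat) (E : set (measurableTypeR R)) :
  measurable E ->
  (forall u v, (forall k, k != m -> symbol k u = symbol k v) -> E u -> E v) ->
  unif01 (E `&` [set u | f (symbol m u)]) =
    (((\sum_(b < M) f b)%:R / M%:R)%:E * unif01 E)%E.
Proof.
move=> mE Einv.
have mEa c : measurable (E `&` [set u | symbol m u = c]).
  by apply: measurableI => //; exact: measurable_symbol.
pose q := unif01 (E `&` [set u | symbol m u = 0%N]).
have qE a : (a < M)%N -> unif01 (E `&` [set u | symbol m u = a]) = q.
  by move=> aM; apply/eqP; rewrite eq_le !symbol_exchange.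
have qfin : q \is a fin_num by exact: fin_num_measure.
have split_ (g : pred nat) : unif01 (E `&` [set u | g (symbol m u)]) =
    ((\sum_(b < M) g b)%:R%:E * q)%E.
  pose F (b : nat) := E `&` [set u | symbol m u = b /\ g b].
  have mF b : measurable (F b).
    rewrite /F; case: (g b).
      rewrite (_ : [set u | _ /\ _] = [set u | symbol m u = b])//.
      by apply/seteqP; split => // u [].
    rewrite (_ : _ `&` _ = set0) ?measurable0//.
    by apply/seteqP; split => // u [_ []].
  have tF : trivIset setT F.
    apply/trivIsetP => i j _ _ ij; apply/seteqP; split => // u /=.
    by move=> [[_ [ui _]] [_ [uj _]]]; move: ij; rewrite -ui -uj eqxx.
  rewrite (_ : E `&` _ = \big[setU/set0]_(b < M) F b); last first.
    rewrite -bigcup_mkord; apply/seteqP; split => u.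
      move=> [Eu /= gu]; exists (symbol m u) => //=.
      by rewrite /symbol ltn_mod.
    by move=> [b _ [Eu [/= -> gb]]].
  transitivity (\sum_(b < M) unif01 (F b))%E.
    exact: measure_bigsetU.
  rewrite natr_sum -sumEFin ge0_sume_distrl; last first.
    by move=> i _; rewrite lee_fin ler0n.
  apply: eq_bigr => i _; rewrite /F; case: (boolP (g i)) => gi.
    rewrite mul1e -(qE i)//; congr (unif01 (E `&` _)).
    by apply/seteqP; split => // u [].
  rewrite mul0e (_ : _ `&` _ = set0) ?measure0//.
  by apply/seteqP; split => // u [_ []].
have Mne : M%:R != 0 :> R by rewrite pnatr_eq0 -lt0n.
have Pq : (M%:R%:E * q = unif01 E)%E.
  have := split_ xpredT; rewrite (_ : [set u | _] = setT); last exact/seteqP.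
  by rewrite setIT => ->; rewrite sum1_card card_ord.
by rewrite split_ -Pq muleA -EFinM divfK.
Qed.

End digits.

(** * Binary coding of points of the cube *)

Lemma cballP (R : realType) d (x y : 'rV[R]_d) (r : R) : 0 <= r ->
  cball x r y <-> forall i, `|x ord0 i - y ord0 i| <= r.
Proof.
move=> r0; rewrite /cball /closed_ball_ /= [leLHS]/Num.Def.normr /= mx_normrE; split.
  move=> /bigmax_leP[_ h] i.
  by have := h (ord0, i) erefl; rewrite /= !mxE.
by move=> h; apply/bigmax_leP; split => // -[i j] _ /=; rewrite (ord1 i) !mxE.
Qed.

Lemma closed_cball (R : realType) d (x : 'rV[R]_d) (r : R) : closed (cball x r).
Proof. exact: closed_closed_ball_. Qed.

Lemma measurable_closed_rV (R : realType) d (A : set (borel_rV R d)) :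
  closed (A : set 'rV[R]_d) -> measurable A.
Proof.
move=> cA; rewrite -[A]setCK; apply: measurableC.
by apply: sub_sigma_algebra; exact: closed_openC.
Qed.

Section coding.
Context (R : realType) (d : nat) (U : Type) (D : nat -> U -> bool).

(** Digit [n * d + i] is the n-th binary digit of coordinate i, so that the first
    [n * d] digits are those of level below n. [addr i n u] is the integer with
    the first n binary digits of coordinate i. *)
Fixpoint addr (i : nat) (n : nat) (u : U) : nat :=
  if n is m.+1 then ((addr i m u).*2 + D (m * d + i) u)%N else 0%N.

Lemma addr_add i n j u :
  (addr i n u * 2 ^ j <= addr i (n + j) u < (addr i n u).+1 * 2 ^ j)%N.
Proof.
elim: j => [|j]; first by rewrite addn0 expn0; lia.
by rewrite addnS expnS /=; case: (D _ u) => /=; lia.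
Qed.

(** The supremum is the sum of the binary series of coordinate i, without
    convergence to prove. *)
Definition coord (i : nat) (u : U) : R :=
  sup (range (fun n => (addr i n u)%:R / 2 ^+ n : R)).

Lemma addr_frac_le i n m u :
  (addr i n u)%:R / 2 ^+ n <= (addr i m u).+1%:R / 2 ^+ m :> R.
Proof.
rewrite ler_pdivrMr ?exprn_gt0// mulrAC ler_pdivlMr ?exprn_gt0//.
rewrite -!natrX -!natrM ler_nat.
have [nm|/ltnW mn] := leqP n m.
- have /andP[h1 h2] := addr_add i n (m - n) u; move: h1 h2.
  rewrite subnKC// => h1 _; have -> : (2 ^ m = 2 ^ (m - n) * 2 ^ n)%N.
    by rewrite -expnD subnK.
  by rewrite mulnA leq_mul2r (leq_trans h1) ?orbT.
- have /andP[h1 h2] := addr_add i m (n - m) u; move: h1 h2.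
  rewrite subnKC// => _ h2; have -> : (2 ^ n = 2 ^ (n - m) * 2 ^ m)%N.
    by rewrite -expnD subnK.
  by rewrite mulnA leq_mul2r (ltnW h2) orbT.
Qed.

Lemma coord_bounds i n u :
  (addr i n u)%:R / 2 ^+ n <= coord i u <= (addr i n u).+1%:R / 2 ^+ n.
Proof.
apply/andP; split.
- apply: ub_le_sup; last by exists n.
  by exists ((addr i n u).+1%:R / 2 ^+ n) => _ [m _ <-]; exact: addr_frac_le.
- apply: ge_sup; first by exists (addr i 0 u)%:R; exists 0%N; rewrite // expr0 divr1.
  by move=> _ [m _ <-]; exact: addr_frac_le.
Qed.

Lemma eq_addr i n u v : (forall j, (j < n)%N -> D (j * d + i) u = D (j * d + i) v) ->
  addr i n u = addr i n v.
Proof.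
elim: n => //= n IH h; rewrite IH ?h// => j jn; apply: h; exact: ltnW.
Qed.

Lemma addr_inj i n u v : addr i n u = addr i n v ->
  forall j, (j < n)%N -> D (j * d + i) u = D (j * d + i) v.
Proof.
elim: n => //= n IH h j.
have hD : D (n * d + i) u = D (n * d + i) v.
  by move: h; case: (D _ u); case: (D _ v) => //=; lia.
rewrite ltnS leq_eqVlt => /orP[/eqP-> //|]; apply: IH.
by move: h; rewrite hD; lia.
Qed.

Definition point (u : U) : 'rV[R]_d := \row_i coord i u.

Definition cube n (c : 'I_d -> nat) : set 'rV[R]_d :=
  [set x | forall i, (c i)%:R <= 2 ^+ n * x ord0 i <= (c i).+1%:R].

Lemma point_in_cube n u : cube n (fun i => addr i n u) (point u).
Proof.
move=> i; rewrite /point mxE; have /andP[h1 h2] := coord_bounds i n u.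
rewrite ler_pdivrMr ?exprn_gt0// in h1; rewrite ler_pdivlMr ?exprn_gt0// in h2.
by rewrite mulrC h1 h2.
Qed.

Lemma closed_cube n c : closed (cube n c).
Proof.
rewrite (_ : cube n c = \bigcap_(i in [set: 'I_d])
   ((fun x : 'rV[R]_d => x ord0 i) @^-1`
     ([set t | (c i)%:R / 2 ^+ n <= t] `&` [set t | t <= (c i).+1%:R / 2 ^+ n]))).
  apply: closed_bigI => i _; apply: (continuous_closedP _).1.
    exact: coord_continuous.
  by apply: closedI; [exact: closed_ge|exact: closed_le].
apply/seteqP; split => x /=.
  move=> h i _ /=; have /andP[h1 h2] := h i.
  by rewrite ler_pdivrMr ?exprn_gt0// ler_pdivlMr ?exprn_gt0// !(mulrC (x _ _)).
move=> h i; have := h i Logic.I.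
by rewrite /= ler_pdivrMr ?exprn_gt0// ler_pdivlMr ?exprn_gt0// !(mulrC (x _ _)) => -[-> ->].
Qed.

Lemma cube_cball n c (x y : 'rV[R]_d) : cube n c x -> cube n c y ->
  cball x (2 ^- n) y.
Proof.
move=> hx hy; apply/cballP => [|i]; first by rewrite invr_ge0 exprn_ge0.
have /andP[x1 x2] := hx i; have /andP[y1 y2] := hy i.
have n0 : 0 < 2 ^+ n :> R by rewrite exprn_gt0.
rewrite -(ler_pM2l n0) divff ?lt0r_neq0// -{1}(gtr0_norm n0) -normrM mulrBr.
rewrite ler_norml; move: x2 y2; rewrite -(natr1 (c i)) => x2 y2; apply/andP; split; lra.
Qed.

Definition prefix N u : set U := [set v | forall m, (m < N)%N -> D m v = D m u].

Lemma prefix_addr n u v :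
  prefix (n * d) u v <-> forall i : 'I_d, addr i n v = addr i n u.
Proof.
split=> [h i|h m mnd].
  apply: eq_addr => j jn; apply: h.
  rewrite (leq_trans _ (_ : j.+1 * d <= n * d)%N)//; last by rewrite leq_mul2r jn orbT.
  by rewrite mulSn addnC ltn_add2r.
have d0 : (0 < d)%N by move: mnd; case: (d) => //; rewrite muln0.
rewrite (divn_eq m d); apply: (@addr_inj (Ordinal (ltn_pmod m d0)) n) => //.
by rewrite ltn_divLR.
Qed.

Definition cubes n (Q : set U) : set 'rV[R]_d :=
  \bigcup_(u in Q) cube n (fun i => addr i n u).

(** There are only countably many cubes of level n, so their union is Borel
    although [Q] is arbitrary. *)
Lemma measurable_cubes n (Q : set U) : measurable (cubes n Q : set (borel_rV R d)).
Proof.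
rewrite (_ : cubes n Q = \bigcup_(c : {ffun 'I_d -> nat})
    if `[< exists2 u, Q u & forall i : 'I_d, c i = addr i n u >] then cube n c else set0).
  apply: countable_bigcupT_measurable => // c; case: ifP => // _.
  by apply: measurable_closed_rV; exact: closed_cube.
apply/seteqP; split => x.
  move=> [u Qu ux]; exists [ffun i : 'I_d => addr i n u] => //.
  rewrite ifT; last by apply/asboolP; exists u => // i; rewrite ffunE.
  by move=> i; rewrite !ffunE; exact: ux.
move=> [c _]; case: ifPn => // /asboolP[u Qu cu] cx; exists u => // i.
by rewrite -cu; exact: cx.
Qed.

End coding.

Section coding_measurability.
Context (R : realType) (d : nat) (dU : measure_display) (U : measurableType dU).
Variable D : nat -> U -> bool.
Hypothesis measurable_digit : forall m, measurable [set u | D m u].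

Lemma measurable_digit_eq m b : measurable [set u | D m u = b].
Proof.
case: b; first exact: measurable_digit.
rewrite (_ : [set u | _] = ~` [set u | D m u]).
  exact: measurableC.
by apply/seteqP; split => u /=; [move=> ->|move/negP/negbTE].
Qed.

Lemma measurable_prefix N u : measurable (prefix D N u).
Proof.
rewrite (_ : prefix D N u = \bigcap_(m in `I_N) [set v | D m v = D m u]).
  by apply: bigcap_measurableType => m _; exact: measurable_digit_eq.
by [].
Qed.

Lemma measurable_addr i n c : measurable [set u | addr d D i n u = c].
Proof.
elim: n c => [|n IH] c /=.
  have [<-|c0] := eqVneq 0%N c.
    by rewrite (_ : [set _ | _] = setT)//; apply/seteqP.
  rewrite (_ : [set _ | _] = set0)//; apply/seteqP; split => // u /= /eqP.
  by rewrite (negbTE c0).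
rewrite (_ : [set u | _] =
    [set u | addr d D i n u = c./2] `&` [set u | D (n * d + i)%N u = odd c]).
  by apply: measurableI => //; exact: measurable_digit_eq.
apply/seteqP; split => u /=.
  by move=> <-; rewrite oddD odd_double halfD odd_double doubleK; case: (D _ u) => /=; rewrite ?addn0.
by move=> [-> ->]; rewrite addnC odd_double_half.
Qed.

Lemma measurable_addrs n (Q : ('I_d -> nat) -> Prop) :
  measurable [set u | Q (fun i => addr d D i n u)].
Proof.
rewrite (_ : [set u | _] = \bigcup_(c : {ffun 'I_d -> nat})
    if `[< Q c >] then \bigcap_(i in [set: 'I_d]) [set u | addr d D i n u = c i] else set0).
  apply: countable_bigcupT_measurable => // c; case: ifP => // _.
  by apply: fin_bigcap_measurable => // i _; exact: measurable_addr.
apply/seteqP; split => u /=.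
  move=> Qu; exists [ffun i : 'I_d => addr d D i n u] => //.
  rewrite ifT; first by move=> i _ /=; rewrite ffunE.
  apply/asboolP; suff -> : [ffun i : 'I_d => addr d D i n u] = (fun i : 'I_d => addr d D i n u) :> ('I_d -> nat) by [].
  by apply/funext => i; rewrite ffunE.
move=> [c _]; case: ifPn => // /asboolP Qc cu.
suff -> : (fun i : 'I_d => addr d D i n u) = c by [].
by apply/funext => i; exact: cu.
Qed.

(** A point lies in an open set as soon as its cube of some level does, and
    cubes are determined by finitely many digits. *)
Lemma measurable_point : measurable_fun setT (point R d D : U -> borel_rV R d).
Proof.
apply: (@measurability _ _ U (borel_rV R d) setT (point R d D) (@open 'rV[R]_d)) => // _ [V oV <-].
rewrite setTI (_ : _ @^-1` _ = \bigcup_n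
    [set u | cube (R:=R) n (fun i => addr d D i n u) `<=` V]).
  apply: bigcup_measurable => n _.
  exact: (measurable_addrs n (fun c => cube (R:=R) n c `<=` V)).
apply/seteqP; split => u /=.
  move=> Vu; have := oV; rewrite openE => /(_ _ Vu) /nbhs_ballP[e /= e0 eV].
  have [n ne] : exists n, 2 ^- n < e.
    have [n _ /(_ n (leqnn n))] := near_infty_natSinv_expn_lt (PosNum e0).
    by exists n; rewrite -[X in X < _]div1r.
  exists n => // x ux; apply: eV; rewrite -ball_normE /=.
  by apply: le_lt_trans ne; have := cube_cball (point_in_cube R D n u) ux.
by move=> [n _]; apply; exact: point_in_cube.
Qed.

End coding_measurability.

(** * Measure of balls and of annuli *)

Section independent_digits.
Context (R : realType) (dU : measure_display) (U : measurableType dU).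
Context (P : probability U R) (d : nat) (D : nat -> U -> bool).
Context (k : nat) (fair slab : pred nat).

(** Three kinds of digits: fair ones, slab digits, which select the heavy slab (1)
    or the light slab (0), and idle ones, which are always 0. *)
Definition digit_prob m : R :=
  if slab m then 1 - 2 ^- k else if fair m then 2^-1 else 0.

Definition free_of_digit m (E : set U) :=
  forall u v, (forall j, j != m -> D j u = D j v) -> E u -> E v.

Hypothesis measurable_digit : forall m, measurable [set u | D m u].
Hypothesis independent_digit : forall m E, measurable E -> free_of_digit m E ->
  P (E `&` [set u | D m u]) = ((digit_prob m)%:E * P E)%E.

Let V2 n : 0 < 2 ^- n :> R.
Proof. by rewrite invr_gt0 exprn_gt0. Qed.

Let V2le1 n : 2 ^- n <= 1 :> R.
Proof. by rewrite invf_le1 ?exprn_gt0// exprn_ege1// ler1n. Qed.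

Lemma independent_digit0 m E : measurable E -> free_of_digit m E ->
  P (E `&` [set u | D m u = false]) = ((1 - digit_prob m)%:E * P E)%E.
Proof.
move=> mE fE; rewrite (_ : _ `&` _ = E `\` [set u | D m u]); last first.
  by apply/seteqP; split => u /=; case: (D m u) => //= -[].
transitivity (P E - P (E `&` [set u | D m u]))%E.
  by apply: measureD => //; rewrite -ge0_fin_numE// fin_num_measure.
rewrite independent_digit// EFinB muleBl ?mul1e//.
exact: fin_num_measure.
Qed.

Lemma measure_prefixS N u :
  P (prefix D N.+1 u) =
  ((if D N u then digit_prob N else 1 - digit_prob N)%:E * P (prefix D N u))%E.
Proof.
have fN : free_of_digit N (prefix D N u).
  by move=> v w vw pv m mN; rewrite -vw ?pv// ltn_eqF.
have mN := measurable_prefix measurable_digit N u.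
rewrite (_ : prefix D N.+1 u = prefix D N u `&` [set v | D N v = D N u]).
  by case: (D N u); [exact: independent_digit|exact: independent_digit0].
apply/seteqP; split => v.
  by move=> h; split; [move=> m mN'; apply: h; exact: ltnW|exact: h].
by move=> [h hN] m; rewrite ltnS leq_eqVlt => /orP[/eqP->|/h].
Qed.

Lemma digit_prob_ge0 m : 0 <= digit_prob m.
Proof.
by rewrite /digit_prob; case: ifP => _; [rewrite subr_ge0|case: ifP => // _; rewrite invr_ge0].
Qed.

Lemma digit_prob_le1 m : digit_prob m <= 1.
Proof.
rewrite /digit_prob; case: ifP => _; first by rewrite gerBl ltW.
by case: ifP => // _; rewrite invf_le1// ler1n.
Qed.

Notation addr := (addr d D).
Notation point := (point R d D).

Lemma measurable_preimage_point (A : set 'rV[R]_d) : closed A ->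
  measurable (point @^-1` A).
Proof.
move=> cA; rewrite -[X in measurable X]setTI.
exact: measurable_point (measurable_closed_rV cA).
Qed.

Lemma addr_quiet i m j v :
  (forall l, (m <= l < m + j)%N -> D (l * d + i) v = false) ->
  addr i (m + j) v = (addr i m v * 2 ^ j)%N.
Proof.
elim: j => [|j IH] h; first by rewrite addn0 expn0 muln1.
rewrite addnS /= h ?leq_addr ?addnS//= addn0 IH => [|l /andP[l1 l2]].
  by rewrite expnS; lia.
by apply: h; rewrite l1 addnS ltnW.
Qed.

(** In coordinate 0 the measure near [x] lives on two slabs of thickness [2 ^- n]
    at distance [2 ^- j.+1]; the other slabs of level j are too far, since the
    digit of level [j.-1] is idle. If [x] is in the light slab, the annulus of
    inner radius less than [2 ^- j.+1 - 2 ^- n] contains what the ball meets of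
    the heavy one. The event [E] of the proof expresses that the point is in the
    ball as far as the other digits are concerned; it is independent of the slab
    digit, so that a fraction [1 - 2 ^- k] of it goes to the heavy slab. *)
Lemma slab_annulus_charged (i0 : 'I_d) j n u x delta eta :
  nat_of_ord i0 = 0%N ->
  (0 < j)%N -> (j.+2 < n)%N -> slab (j * d)%N ->
  (forall l v, (j <= l.+1)%N -> (l < n)%N -> l != j -> D (l * d) v = false) ->
  D (j * d) u = false -> cube n (fun i => addr i n u) x ->
  2 * 2 ^- n < (2 ^- j.+1 + 2 ^- n) `^ delta ->
  0 <= eta <= 1 - 2 ^- k ->
  (eta%:E * P (point @^-1` cball x (2 ^- j.+1 + 2 ^- n)) <=
   P (point @^-1` annulus x (2 ^- j.+1 + 2 ^- n) delta))%E.
Proof.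
move=> i00 j0 jn sj quiet ju ux dr /andP[eta0 ek]; set r := 2 ^- j.+1 + 2 ^- n in dr *.
have r0 : 0 <= r by rewrite addr_ge0// ltW.
have n0 : 0 < 2 ^+ n :> R by rewrite exprn_gt0.
pose a v := addr 0 j.-1 v.
(* the distance of the two slabs, in units of [2 ^- n] *)
pose H := (2 ^ (n - j.+1))%N.
have H4 : (4 <= H)%N.
  by rewrite (_ : 4 = 2 ^ 2)%N// leq_exp2l//; move: jn; lia.
have aE v : addr 0 n v = ((4 * a v + D (j * d) v) * H)%N.
  rewrite -(subnKC (ltnW (ltnW jn))) addr_quiet => [|l /andP[l1 l2]].
    rewrite /= -{1}(prednK j0) /= addn0.
    have := quiet j.-1 v; rewrite prednK// => -> //; try lia.
    by rewrite addn0; rewrite /a /H; congr (_ * _)%N; lia.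
  rewrite addn0; apply: quiet; lia.
have nh : 2 ^+ n * 2 ^- j.+1 = H%:R :> R.
  by rewrite /H natrX -{1}(subnKC (ltnW (ltnW jn))) exprD; field; apply: lt0r_neq0.
have nr : 2 ^+ n * r = H%:R + 1 by rewrite /r mulrDr nh divff// lt0r_neq0.
have H4R : 4 <= H%:R :> R by rewrite ler_nat.
have dist v : 2 ^+ n * `|x ord0 i0 - point v ord0 i0| =
    `|2 ^+ n * x ord0 i0 - 2 ^+ n * point v ord0 i0|.
  by rewrite -{1}(gtr0_norm n0) -normrM mulrBr.
have cubeP v : [/\ (addr 0 n u)%:R <= 2 ^+ n * x ord0 i0,
     2 ^+ n * x ord0 i0 <= (addr 0 n u)%:R + 1,
     (addr 0 n v)%:R <= 2 ^+ n * point v ord0 i0 &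
     2 ^+ n * point v ord0 i0 <= (addr 0 n v)%:R + 1].
  have /andP[u1 u2] := ux i0; have /andP[v1 v2] := point_in_cube R D n v i0.
  by move: u1 u2 v1 v2; rewrite i00 -!(natr1 (addr _ _ _)).
pose C := [set y : 'rV[R]_d | forall i, i != i0 -> `|x ord0 i - y ord0 i| <= r].
have cC : closed C.
  rewrite (_ : C = \bigcap_(i in [set i | i != i0])
     ((fun y : 'rV[R]_d => y ord0 i) @^-1`
       ([set t | x ord0 i - r <= t] `&` [set t | t <= x ord0 i + r]))).
    apply: closed_bigI => i _; apply: (continuous_closedP _).1.
      exact: coord_continuous.
    by apply: closedI; [exact: closed_ge|exact: closed_le].
  apply/seteqP; split => y /= h i ii0; have := h i ii0 => /=.
    by rewrite ler_norml => /andP[y1 y2]; split; lra.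
  by move=> [y1 y2]; rewrite ler_norml; apply/andP; split; lra.
pose E := [set v | a v = a u] `&` point @^-1` C.
have mE : measurable E.
  apply: measurableI; first by rewrite /a; apply: measurable_addr.
  exact: measurable_preimage_point.
have fE : free_of_digit (j * d) E.
  move=> v w vw [av Cv]; split => /=.
    rewrite -av; apply: eq_addr => l lj; apply/esym/vw; rewrite addn0.
    by rewrite eqn_pmul2r; [lia|rewrite (leq_trans _ (ltn_ord i0))].
  move=> i ii0; suff -> : point w ord0 i = point v ord0 i by exact: Cv.
  rewrite !mxE /coord; congr (sup _); apply/seteqP.
  have ad l : addr i l v = addr i l w.
    apply: eq_addr => l' _; apply: vw; apply/eqP => h.
    have : ((l' * d + i) %% d = (j * d + 0) %% d)%N by rewrite h addn0.
    rewrite !modnMDl mod0n modn_small// => i0'.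
    by move: ii0; rewrite -val_eqE/= i0' i00.
  by split => _ [l _ <-]; exists l; rewrite // ad.
have BE : point @^-1` cball x r `<=` E.
  move=> v /= /(cballP _ _ r0) xv; split => [/=|i _]; last exact: xv.
  have := xv i0; rewrite -(ler_pM2l n0) dist nr ler_norml => /andP[x1 x2].
  have [c1 c2 c3 c4] := cubeP v.
  have e1 : ((addr 0 n v)%:R <= (addr 0 n u)%:R + H%:R + 2 :> R) by lra.
  have e2 : ((addr 0 n u)%:R <= (addr 0 n v)%:R + H%:R + 2 :> R) by lra.
  move: e1 e2; rewrite -!natrD !ler_nat !aE ju.
  case: (D (j * d) v) => /=; move: H4; clear; nia.
have mB := measurable_preimage_point (closed_cball (x := x) (r := r)).
apply: (@le_trans _ _ ((1 - 2 ^- k)%:E * P E)%E).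
  by apply: lee_pmul => //; apply: le_measure; rewrite ?inE.
have -> : 1 - 2 ^- k = digit_prob (j * d) by rewrite /digit_prob sj.
rewrite -(independent_digit mE fE).
apply: le_measure; rewrite ?inE.
- exact: measurableI.
- apply: (measurableD mB); apply: measurable_preimage_point.
  exact: closed_cball.
move=> v [[/= av Cv] jv].
have [c1 c2 c3 c4] := cubeP v.
have aH : (addr 0 n v)%:R = (addr 0 n u)%:R + H%:R :> R.
  by rewrite -natrD !aE av ju jv /= addn0 mulnDl mul1n.
split.
  apply/(cballP _ _ r0) => i; have [->|] := eqVneq i i0; last exact: Cv.
  rewrite -(ler_pM2l n0) dist nr ler_norml; apply/andP; split; lra.
rewrite /cball /closed_ball_ /= => xv.
have : `|x ord0 i0 - point v ord0 i0| <= r - r `^ delta.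
  by apply: (cballP _ _ (le_trans (normr_ge0 _) xv)).1.
apply/negP; rewrite -ltNge -(ltr_pM2l n0) dist mulrBr nr.
have : 2 < 2 ^+ n * r `^ delta.
  by rewrite -(ltr_pM2l n0) mulrCA divff ?lt0r_neq0 ?mulr1 in dr.
move=> dr'; rewrite ltr_normr; apply/orP; right; lra.
Qed.

(** Second Borel-Cantelli lemma: the probability that [s] given slab digits all
    select the heavy slab is [(1 - 2 ^- k) ^+ s]. *)
Lemma light_slab_infinitely_often (m_ : nat -> nat) :
  injective m_ -> (forall t, slab (m_ t)) ->
  {ae P, forall u N, exists2 t, (N <= t)%N & D (m_ t) u = false}.
Proof.
move=> m_inj m_slab.
pose heavy N s := [set u | forall t, (t < s)%N -> D (m_ (N + t)) u].
have heavyS N s : heavy N s.+1 = heavy N s `&` [set u | D (m_ (N + s)) u].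
  apply/seteqP; split => u.
    by move=> h; split; [move=> t ts; apply: h; exact: ltnW|exact: h].
  by move=> [h hs] t; rewrite ltnS leq_eqVlt => /orP[/eqP->|/h].
have mheavy N s : measurable (heavy N s).
  elim: s => [|s IH]; last by rewrite heavyS; exact: measurableI.
  by rewrite (_ : heavy N 0 = setT)//; apply/seteqP; split.
have Pheavy N s : P (heavy N s) = ((1 - 2 ^- k) ^+ s)%:E.
  elim: s => [|s IH].
    by rewrite (_ : heavy N 0 = setT) ?probability_setT//; apply/seteqP; split.
  rewrite heavyS independent_digit//; last first.
    move=> u v uv h t ts; rewrite -uv ?h//.
    by apply/eqP => /m_inj /eqP; rewrite eqn_add2l ltn_eqF.
  by rewrite IH /digit_prob m_slab -EFinM exprS.
pose never N := \bigcap_s heavy N s.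
have mnever N : measurable (never N) by exact: bigcapT_measurable.
have Pnever N : P (never N) = 0%E.
  apply/eqP; rewrite eq_le measure_ge0 andbT.
  apply/lee_addgt0Pr => e e0; rewrite add0e.
  have q1 : `|1 - 2 ^- k| < 1 :> R.
    rewrite ger0_norm ?subr_ge0// gtrBl //.
  have /cvgrPdist_lt/(_ _ e0)[s _ /(_ s (leqnn s))] := cvg_expr q1.
  rewrite /= sub0r normrN ger0_norm ?exprn_ge0 ?subr_ge0// => se.
  apply: le_trans (_ : P (heavy N s) <= _)%E; last by rewrite Pheavy lee_fin ltW.
  by apply: le_measure; rewrite ?inE// => u; apply.
exists (\bigcup_N never N); split.
- exact: bigcupT_measurable.
- apply/(negligibleP _ (bigcupT_measurable _ mnever)).
  apply: negligible_bigcup => N.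
  apply/(negligibleP _ (mnever N)); exact: Pnever.
move=> u /= nG; apply: contrapT => h; apply: nG => N.
apply: contrapT => hN; apply: h; exists N => // s _ t ts /=.
apply: contrapT => /negP/negbTE Dt; apply: hN; exists (N + t)%N => //.
exact: leq_addr.
Qed.

Hypothesis fair_not_slab : forall m, fair m -> ~~ slab m.

Lemma prefix_measure_le N u :
  (P (prefix D N u) <= (2 ^- (\sum_(m < N) fair m)%N)%:E)%E.
Proof.
elim: N => [|N IH].
  by rewrite big_ord0 expr0 invr1; exact/probability_le1/measurable_prefix.
rewrite measure_prefixS big_ord_recr/= exprD invfM mulrC EFinM.
apply: lee_pmul => //.
- by rewrite lee_fin; case: ifP => _; rewrite ?subr_ge0 ?digit_prob_le1 ?digit_prob_ge0.
rewrite lee_fin; have [fN|_] := boolP (fair N); last first.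
  rewrite expr0 invr1; case: ifP => _; first exact: digit_prob_le1.
  by rewrite gerBl digit_prob_ge0.
rewrite /digit_prob (negbTE (fair_not_slab fN)) fN expr1.
by case: ifP => _; lra.
Qed.

Lemma measure_bigsetU_le (I : Type) (s : seq I) (A : I -> set U) :
  (forall i, measurable (A i)) ->
  (P (\big[setU/set0]_(i <- s) A i) <= \sum_(i <- s) P (A i))%E.
Proof.
move=> mA; elim: s => [|i s IH]; first by rewrite !big_nil measure0.
rewrite !big_cons; apply: le_trans (measureU2 _ _ _) _ => //.
  exact: bigsetU_measurable.
by apply: leeD.
Qed.

(** A ball of radius [2 ^- n] centred in a cube of level n meets at most five cubes
    of that level per coordinate, and each of them has at most the measure of a
    prefix. Five is rounded up to eight, a power of two. *)
Lemma ball_measure_le n u x : cube n (fun i => addr i n u) x ->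
  (P (point @^-1` cball x (2 ^- n)) <=
   (2 ^+ (3 * d) * 2 ^- (\sum_(m < n * d) fair m)%N)%:E)%E.
Proof.
move=> ux.
pose A (f : {ffun 'I_d -> 'I_8}) :=
  [set v | forall i : 'I_d, (addr i n v + 2 = addr i n u + f i)%N].
have mA f : measurable (A f).
  exact: (measurable_addrs measurable_digit n
    (fun c : 'I_d -> nat => forall i : 'I_d, c i + 2 = addr i n u + f i)%N).
have PA f : (P (A f) <= (2 ^- (\sum_(m < n * d) fair m)%N)%:E)%E.
  have [->|/set0P[v vA]] := eqVneq (A f) set0.
    by rewrite measure0 lee_fin ltW.
  apply: le_trans (prefix_measure_le (n * d) v).
  apply: le_measure; rewrite ?inE//; first exact: measurable_prefix.
  move=> w wA; apply/prefix_addr => i.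
  by apply/eqP; rewrite -(eqn_add2r 2) wA vA.
apply: (@le_trans _ _ (P (\big[setU/set0]_(f : {ffun 'I_d -> 'I_8}) A f))).
  apply: le_measure; rewrite ?inE.
  - exact/measurable_preimage_point/closed_cball.
  - exact: bigsetU_measurable.
  move=> v /= /(cballP _ _ (ltW (V2 n))) xv.
  rewrite -bigcup_seq /=.
  (* the shift by 2 makes the five possible differences natural numbers *)
  exists [ffun i : 'I_d => inord (addr i n v + 2 - addr i n u) : 'I_8].
    by rewrite /= mem_index_enum.
  move=> i /=; rewrite ffunE.
  have n0 : 0 < 2 ^+ n :> R by rewrite exprn_gt0.
  have := xv i; rewrite -(ler_pM2l n0) divff ?lt0r_neq0// -{1}(gtr0_norm n0).
  rewrite -normrM mulrBr ler_norml => /andP[b1 b2].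
  have /andP[u1 u2] := ux i; have /andP[v1 v2] := point_in_cube R D n v i.
  rewrite -(natr1 (addr i n u)) in u2; rewrite -(natr1 (addr i n v)) in v2.
  have c1 : (addr i n u <= addr i n v + 2)%N by rewrite -(ler_nat R) natrD; lra.
  have c2 : (addr i n v <= addr i n u + 2)%N by rewrite -(ler_nat R) natrD; lra.
  by rewrite inordK; lia.
apply: le_trans (measure_bigsetU_le _ mA) _.
apply: le_trans (lee_sum _ (fun f _ => PA f)) _.
rewrite sumEFin lee_fin sumr_const card_ffun !card_ord -[X in X <= _]mulr_natl.
by rewrite (_ : 8 = 2 ^ 3)%N// -expnM natrX.
Qed.

Hypothesis idle_digit : forall m u, D m u -> slab m || fair m.
Hypothesis k_gt0 : (0 < k)%N.

(** The factor [2 ^- k] for each slab digit accounts for the light slab. *)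
Lemma prefix_measure_ge N u :
  ((2 ^- (\sum_(m < N) (fair m + k * slab m))%N)%:E <= P (prefix D N u))%E.
Proof.
elim: N => [|N IH].
  rewrite big_ord0 expr0 invr1 (_ : prefix _ _ _ = setT) ?probability_setT//.
  by apply/seteqP; split.
rewrite measure_prefixS big_ord_recr/= exprD invfM mulrC EFinM.
apply: lee_pmul => //.
rewrite lee_fin; have [fN|nfN] := boolP (fair N).
  rewrite /digit_prob (negbTE (fair_not_slab fN)) fN muln0 addn0 expr1.
  by case: ifP => _; lra.
have [sN|nsN] := boolP (slab N).
  rewrite /digit_prob sN muln1 add0n; case: ifP => _; last by lra.
  rewrite -(prednK k_gt0) exprS invfM.
  have := V2le1 k.-1; lra.
rewrite muln0 addn0 expr0 invr1 ifF; last first.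
  by apply/negP => /idle_digit; rewrite (negbTE nfN) (negbTE nsN).
by rewrite /digit_prob (negbTE nsN) (negbTE nfN) subr0.
Qed.

Lemma ball_measure_ge n u x : cube n (fun i => addr i n u) x ->
  ((2 ^- (\sum_(m < n * d) (fair m + k * slab m))%N)%:E
   <= P (point @^-1` cball x (2 ^- n)))%E.
Proof.
move=> ux; apply: le_trans (prefix_measure_ge (n * d) u) _.
apply: le_measure; rewrite ?inE; [exact: measurable_prefix| |].
  exact/measurable_preimage_point/closed_cball.
move=> v /prefix_addr uv /=; apply: cube_cball ux _.
by move=> i; rewrite -uv; exact: point_in_cube.
Qed.

End independent_digits.

(** * Digits of the three kinds from uniform symbols *)

Section digit_construction.
Context (R : realType) (k : nat) (fair slab : pred nat).
Hypothesis k_gt0 : (0 < k)%N.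

(** With [2 ^ k] equally likely symbols, the event that the symbol is nonzero has
    probability [1 - 2 ^- k], and half of the symbols make a fair digit. *)
Definition digit (m : nat) (u : measurableTypeR R) : bool :=
  if slab m then symbol (2 ^ k) m u != 0%N
  else fair m && (symbol (2 ^ k) m u < 2 ^ k.-1)%N.

Let M_gt0 : (0 < 2 ^ k)%N. Proof. by rewrite expn_gt0. Qed.

Lemma measurable_digit m : measurable [set u | digit m u].
Proof.
rewrite (_ : [set u | _] = \bigcup_(a in [set a | if slab m then a != 0%N
    else fair m && (a < 2 ^ k.-1)%N]) [set u | symbol (2 ^ k) m u = a]).
  by apply: bigcup_measurable => a _; exact: measurable_symbol.
apply/seteqP; split => u; first by move=> ?; exists (symbol (2 ^ k) m u).
by move=> [a /= + ua]; rewrite /digit ua.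
Qed.

Lemma digit_idle m u : digit m u -> slab m || fair m.
Proof. by rewrite /digit; case: ifP => // _ /andP[->]. Qed.

Lemma digit_independent m (E : set (measurableTypeR R)) :
  measurable E -> free_of_digit digit m E ->
  unif01 (E `&` [set u | digit m u]) = ((digit_prob R k fair slab m)%:E * unif01 E)%E.
Proof.
move=> mE fE.
have fE' u v : (forall j, j != m -> symbol (2 ^ k) j u = symbol (2 ^ k) j v) -> E u -> E v.
  by move=> uv; apply: fE => j jm; rewrite /digit uv.
pose f a := if slab m then a != 0%N else fair m && (a < 2 ^ k.-1)%N.
have := symbol_independent M_gt0 f mE fE'.
rewrite (_ : [set u | f _] = [set u | digit m u])// => ->; congr (_%:E * _)%E.
have M0 : (2 ^ k)%:R != 0 :> R by rewrite pnatr_eq0 -lt0n.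
apply: (mulIf M0); rewrite divfK// /digit_prob /f.
case: ifP => sm.
  have -> : (\sum_(b < 2 ^ k) (nat_of_ord b != 0%N) = 2 ^ k - 1)%N.
    rewrite -(big_mkord xpredT (fun b => (b != 0%N) : nat)).
    rewrite -{1}(prednK M_gt0) big_nat_recl//= add0n.
    by rewrite sum_nat_const_nat muln1 subn0 subn1.
  by rewrite natrB// mulrBl mul1r -natrX mulVf.
case: ifP => fm; last by rewrite mul0r big1.
rewrite -[in RHS](prednK k_gt0) expnS natrM mulrA mulVf// mul1r; congr (_%:R).
rewrite -(big_mkord xpredT (fun b => (b < 2 ^ k.-1)%N : nat)).
rewrite (@big_cat_nat _ _ _ (2 ^ k.-1)%N)//=; last by rewrite leq_exp2l// leq_pred.
rewrite big_nat (eq_bigr (fun=> 1%N)) => [|i /andP[_ h]]; last by rewrite h.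
rewrite -big_nat sum_nat_const_nat muln1 subn0 big_nat big1 ?addn0// => i /andP[h _].
by rewrite ltnNge h.
Qed.

End digit_construction.

(** * Dimensions from the measure of dyadic balls *)

Section dimensions.
Context (R : realType) (d : nat) (mu : probability (borel_rV R d) R).
Context (K : set (borel_rV R d)) (c : nat) (J S : nat -> nat).
Hypothesis measurable_K : measurable K.
Hypothesis mu_K : mu K = 1%E.
Hypothesis ball_le : forall x n, K x ->
  (mu (cball x (2 ^- n)) <= (2 ^+ c * 2 ^- J n)%:E)%E.
Hypothesis ball_ge : forall x n, K x ->
  ((2 ^- S n)%:E <= mu (cball x (2 ^- n)))%E.

Lemma dyadic_radius (r : R) N : 0 < r < 2 ^- N ->
  exists2 n, (N <= n)%N & 2 ^- n.+1 < r <= 2 ^- n.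
Proof.
move=> /andP[r0 rN].
have ex : exists n, 2 ^- n < r.
  have [n _ /(_ n (leqnn n))] := near_infty_natSinv_expn_lt (PosNum r0).
  by exists n; rewrite -[X in X < _]div1r.
have [n nr nmin] := ex_minnP ex.
have Nn : (N < n)%N.
  rewrite ltnNge; apply/negP => nN; have := lt_trans nr rN.
  by rewrite ltf_pV2 ?posrE ?exprn_gt0// ltr_eXn2l// ?ltr1n// ltnNge nN.
case: n nr nmin Nn => // n nr nmin Nn; exists n => //; rewrite nr /= leNgt.
by apply/negP => /nmin; rewrite ltnn.
Qed.

Lemma powR_dyadic n (a : R) : (2 ^- n) `^ a = 2 `^ (- (a * n%:R)) :> R.
Proof. by rewrite -powR_invn// -powRrM; congr (_ `^ _); ring. Qed.

Lemma dyadicE n : 2 ^- n = 2 `^ (- n%:R) :> R.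
Proof. by rewrite powR_invn. Qed.

Lemma ltr_powR2 (x y : R) : x < y -> 2 `^ x < 2 `^ y :> R.
Proof.
move=> xy; rewrite /powR (negbTE (_ : 2 != 0 :> R))//.
by rewrite ltr_expR ltr_pM2r// ln_gt0// ltr1n.
Qed.

Lemma cball_measure_mono x (r s : R) : r <= s ->
  (mu (cball x r) <= mu (cball x s))%E.
Proof.
move=> rs; apply: le_measure; rewrite ?inE.
- by apply: measurable_closed_rV; exact: closed_cball.
- by apply: measurable_closed_rV; exact: closed_cball.
- by move=> y /le_trans; apply.
Qed.

Lemma ae_on_K (Q : borel_rV R d -> Prop) :
  (forall x, K x -> Q x) -> {ae mu, forall x, Q x}.
Proof.
move=> KQ; exists (~` K); split; first exact: measurableC.
  by rewrite probability_setC// mu_K subee.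
by apply: subsetC => x /KQ.
Qed.

Lemma ae_some_K (Q : borel_rV R d -> Prop) :
  {ae mu, forall x, Q x} -> exists2 x, K x & Q x.
Proof.
move=> aeQ; apply: contrapT => h.
have : mu.-negligible K.
  by apply: negligibleS aeQ => x Kx Qx; apply: h; exists x.
move=> nK; have : mu K = 0%E by apply/(negligibleP _ measurable_K).
by rewrite mu_K => /eqP; rewrite onee_eq0.
Qed.

Lemma lower_dimE (a : R) : 0 <= a ->
  (forall b, 0 <= b -> b < a -> exists N, forall n, (N <= n)%N ->
    b * n.+1%:R + c%:R <= (J n)%:R) ->
  (forall b N, a < b -> exists2 n, (N <= n)%N & (S n)%:R + 1 <= b * n%:R) ->
  lower_dim mu = a%:E.
Proof.
move=> a0 growth oscillation; apply/eqP; rewrite eq_le; apply/andP; split.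
  apply: ge_ereal_sup => _ [b [b0 /ae_some_K[x Kx [rx rx0 xb]]] <-].
  rewrite lee_fin leNgt; apply/negP => ab.
  have [N _ /(_ N (leqnn N))] := near_infty_natSinv_expn_lt (PosNum rx0).
  rewrite div1r => Nrx.
  have [n Nn Sn] := oscillation b N ab.
  have := xb (2 ^- n); rewrite invr_gt0 exprn_gt0//= (le_lt_trans _ Nrx); last first.
    by rewrite lef_pV2 ?posrE ?exprn_gt0// ler_weXn2l// ler1n.
  move=> /(_ isT) /(le_trans (ball_ge n Kx)).
  rewrite lee_fin powR_dyadic dyadicE; apply/negP; rewrite -ltNge.
  by apply: ltr_powR2; lra.
have dim b : 0 <= b -> b < a \/ b = 0 -> (b%:E <= lower_dim mu)%E.
  move=> b0 ba; apply: ereal_sup_ubound; exists b => //; split => //.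
  apply: ae_on_K => x Kx; case: ba => [ba|->]; last first.
    exists 1 => // r _; rewrite powRr0; apply: probability_le1.
    by apply: measurable_closed_rV; exact: closed_cball.
  have [N HN] := growth b b0 ba.
  exists (2 ^- N); first by rewrite invr_gt0 exprn_gt0.
  move=> r /dyadic_radius[n Nn /andP[nr rn]].
  apply: le_trans (cball_measure_mono x rn) _; apply: le_trans (ball_le n Kx) _.
  rewrite lee_fin; apply: (@le_trans _ _ ((2 ^- n.+1) `^ b)); last first.
    apply: ge0_ler_powR => //; rewrite ?nnegrE ?invr_ge0 ?exprn_ge0//; last exact: ltW.
    by apply: le_trans (ltW nr); rewrite invr_ge0 exprn_ge0.
  rewrite powR_dyadic dyadicE -powR_mulrn// -powRD ?pnatr_eq0 ?implybT//.
  by rewrite ler_powR ?ler1n//; have := HN n Nn; lra.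
apply/lee_addgt0Pr => e e0.
rewrite -leeBlDr// -EFinB; have [ea|ea] := ltP 0 (a - e).
  by apply: dim; [exact: ltW|left; lra].
apply: le_trans (dim 0 (lexx _) (or_intror erefl)).
by rewrite lee_fin.
Qed.

Lemma upper_dimE (a : R) : 0 <= a ->
  (forall b, a < b -> exists N, forall n, (N <= n)%N ->
    (S n.+1)%:R <= b * n%:R) ->
  (forall b N, b < a -> exists2 n, (N <= n)%N &
    b * n%:R + (c%:R + 1) <= (J n)%:R) ->
  upper_dim mu = a%:E.
Proof.
move=> a0 growth oscillation; apply/eqP; rewrite eq_le; apply/andP; split; last first.
  apply: le_ereal_inf_tmp => _ [b [b0 /ae_some_K[x Kx [rx rx0 xb]]] <-].
  rewrite lee_fin leNgt; apply/negP => ba.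
  have [N _ /(_ N (leqnn N))] := near_infty_natSinv_expn_lt (PosNum rx0).
  rewrite div1r => Nrx.
  have [n Nn Jn] := oscillation b N ba.
  have := xb (2 ^- n); rewrite invr_gt0 exprn_gt0//= (le_lt_trans _ Nrx); last first.
    by rewrite lef_pV2 ?posrE ?exprn_gt0// ler_weXn2l// ler1n.
  move=> /(_ isT) h; have := le_trans h (ball_le n Kx).
  rewrite lee_fin powR_dyadic dyadicE -powR_mulrn// -powRD ?pnatr_eq0 ?implybT//.
  apply/negP; rewrite -ltNge.
  by apply: ltr_powR2; lra.
apply/lee_addgt0Pr => e e0; rewrite -EFinD.
have ae : a < a + e by rewrite ltrDl.
apply: ereal_inf_lbound; exists (a + e) => //; split; first by rewrite addr_ge0// ltW.
apply: ae_on_K => x Kx.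
have [N HN] := growth _ ae.
exists (2 ^- N); first by rewrite invr_gt0 exprn_gt0.
move=> r rN; have r0 : 0 <= r by case/andP : rN => /ltW.
have [n Nn /andP[nr rn]] := dyadic_radius rN.
apply: le_trans (cball_measure_mono x (ltW nr)); apply: le_trans (ball_ge n.+1 Kx).
rewrite lee_fin; apply: (@le_trans _ _ ((2 ^- n) `^ (a + e))).
  by apply: ge0_ler_powR => //; rewrite ?nnegrE ?invr_ge0 ?exprn_ge0// addr_ge0// ltW.
rewrite powR_dyadic dyadicE.
by rewrite ler_powR ?ler1n//; have := HN n Nn; lra.
Qed.

End dimensions.

(** * Growth of the number of fair digits *)

Section profile.
Context (R : realType) (d : nat) (dlow dup : R).
Hypothesis dlow_ge0 : 0 <= dlow.
Hypothesis dlow_dup : dlow <= dup.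
Hypothesis dup_le : dup <= d%:R.

(** Each phase starts at the square of the start of the previous one, so that all
    earlier phases are negligible at the end of a phase. *)
Definition phase_start (p : nat) : nat := (2 ^ (2 ^ p))%N.
Definition phase (n : nat) : nat := trunc_log 2 (trunc_log 2 n).
Definition low_level (n : nat) : bool := ~~ odd (phase n).
Definition slope (n : nat) : R := if low_level n then dlow else dup.
(** The slope is [dlow] in the even phases and [dup] in the odd ones: the average
    of the slopes up to n accumulates exactly on the interval from [dlow] to
    [dup]. *)
Definition exponent (n : nat) : R := \sum_(j < n) slope j.
Definition fair_total (n : nat) : nat := Num.truncn (exponent n).
Definition fair_number (n : nat) : nat := (fair_total n.+1 - fair_total n)%N.
(** Coordinate 0 has no fair digit in an even phase. With the slab at the second
    level of the phase, and not at the first, coordinate 0 is idle right before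
    the slab digit too. *)
Definition slab_level (n : nat) : bool :=
  low_level n && (n == (phase_start (phase n)).+1).
(** The fair digits of a level go to the last coordinates, hence to coordinate 0
    only if all d coordinates receive one. *)
Definition fair_digit (m : nat) : bool := (d - fair_number (m %/ d) <= m %% d)%N.
Definition slab_digit (m : nat) : bool := (m %% d == 0)%N && slab_level (m %/ d).
Definition slab_total (n : nat) : nat := (\sum_(j < n) slab_level j)%N.

Lemma phase_startS p : phase_start p.+1 = (phase_start p * phase_start p)%N.
Proof. by rewrite /phase_start expnS mul2n -addnn expnD. Qed.

Lemma phase_start_gt p : (p.+1 < phase_start p)%N.
Proof.
apply: leq_ltn_trans (_ : 2 ^ p < _)%N; last exact: ltn_expl.
exact: ltn_expl.
Qed.

Lemma phase_eq p n : (phase_start p <= n < phase_start p.+1)%N -> phase n = p.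
Proof.
rewrite /phase_start => /andP[h1 h2]; apply: trunc_log_eq => //.
apply/andP; split.
  by apply: trunc_log_max.
rewrite ltnNge; apply/negP => h.
have n0 : (0 < n)%N by rewrite (leq_trans _ h1)// expn_gt0.
have := trunc_logP (isT : 1 < 2)%N n0; rewrite leqNgt => /negP; apply.
by apply: leq_trans h2 _; rewrite leq_exp2l.
Qed.

Lemma phase_bounds n : (1 < n)%N ->
  (phase_start (phase n) <= n < phase_start (phase n).+1)%N.
Proof.
move=> n1; have n0 := ltnW n1.
have t0 : (0 < trunc_log 2 n)%N by apply: trunc_log_max.
apply/andP; split.
  apply: leq_trans (trunc_logP (isT : 1 < 2)%N n0).
  by rewrite leq_exp2l//; apply: trunc_logP.
apply: leq_trans (trunc_log_ltn n (isT : 1 < 2)%N) _.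
by rewrite leq_exp2l//; apply: trunc_log_ltn.
Qed.

Lemma slope_bounds n : dlow <= slope n <= dup.
Proof. by rewrite /slope; case: ifP; rewrite lexx dlow_dup. Qed.

Lemma exponentS n : exponent n.+1 = exponent n + slope n.
Proof. by rewrite /exponent big_ord_recr. Qed.

Lemma exponent_add n j : dlow * j%:R <= exponent (n + j) - exponent n <= dup * j%:R.
Proof.
elim: j => [|j IH]; first by rewrite addn0 subrr !mulr0 lexx.
rewrite addnS exponentS -natr1 !mulrDr !mulr1.
have /andP[h1 h2] := slope_bounds (n + j); move/andP: IH => [h3 h4].
by apply/andP; split; lra.
Qed.

Lemma exponent_bounds n : dlow * n%:R <= exponent n <= dup * n%:R.
Proof.
have e0 : exponent 0 = 0 by rewrite /exponent big_ord0.
by have := exponent_add 0 n; rewrite add0n e0 subr0.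
Qed.

Lemma exponent_ge0 n : 0 <= exponent n.
Proof.
by have /andP[+ _] := exponent_bounds n; apply: le_trans; rewrite mulr_ge0.
Qed.

Lemma fair_total_bounds n :
  exponent n - 1 <= (fair_total n)%:R <= exponent n.
Proof.
have /andP[h1 h2] := truncn_itv (exponent_ge0 n).
by rewrite h1 lerBlDr natr1 ltW.
Qed.

Lemma fair_total_mono n : (fair_total n <= fair_total n.+1)%N.
Proof.
apply: le_truncn; rewrite exponentS lerDl.
by have /andP[h _] := slope_bounds n; apply: le_trans h.
Qed.

Lemma fair_number_le n (b : nat) : slope n <= b%:R -> (fair_number n <= b)%N.
Proof.
move=> nb; rewrite leq_subLR -ltnS -addnS.
rewrite truncn_lt_nat ?exponent_ge0// exponentS.
have /andP[_ h] := truncn_itv (exponent_ge0 n).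
by rewrite addnS -addSn natrD ltr_leD.
Qed.

Lemma fair_number_le_d n : (fair_number n <= d)%N.
Proof.
by apply: fair_number_le; have /andP[_ h] := slope_bounds n; apply: le_trans dup_le.
Qed.

Lemma slab_total_le p n : (n <= phase_start p)%N -> (slab_total n <= p)%N.
Proof.
elim: p n => [|p IH] n np.
  rewrite leqn0 /slab_total big1// => j _.
  have : (j < 2)%N by rewrite (leq_trans _ np).
  by rewrite /slab_level; case: (nat_of_ord j) => [|[|]].
have [/IH/leqW//|pn] := leqP n (phase_start p).
rewrite /slab_total -(big_mkord xpredT (fun j => slab_level j : nat)).
rewrite (@big_cat_nat _ _ _ (phase_start p))//= ?(ltnW pn)//.
rewrite big_mkord -addn1 leq_add// ?IH//.
rewrite big_nat.
apply: (@leq_trans (\sum_(phase_start p <= j < n) (j == (phase_start p).+1))%N).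
  rewrite [X in (_ <= X)%N]big_nat; apply: leq_sum => j /andP[j1 j2].
  rewrite /slab_level (@phase_eq p) ?j1 ?(leq_trans j2)//.
  by case: (low_level j).
rewrite -big_mkcond/= sum1_count.
by rewrite count_uniq_mem ?iota_uniq// leq_b1.
Qed.

Lemma slab_total_sqr n : (slab_total n * slab_total n <= n)%N.
Proof.
have [n2|n1] := ltnP 1 n; last first.
  have := @slab_total_le 0 n (leq_trans n1 _); rewrite leqn0 => /(_ isT)/eqP->.
  by rewrite muln0.
have /andP[h1 h2] := phase_bounds n2.
have := slab_total_le (ltnW h2); set p := phase n in h1 *.
move=> sp; apply: leq_trans h1; apply: leq_trans (_ : (2 ^ p * 2 ^ p) <= _)%N.
  by rewrite leq_mul// (leq_trans sp)// ltn_expl.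
rewrite -expnD leq_exp2l//.
by elim: (p) => [|[|[|q]] IH] //; rewrite expnS; move: IH; rewrite !expnS; have := expn_gt0 2 q; lia.
Qed.

(** It is applied to the slab digits, and to the levels before the current phase. *)
Lemma sqrt_negligible (C e : R) : 0 <= C -> 0 < e ->
  exists N, forall n q, (N <= n)%N -> (q * q <= n)%N -> C * (q%:R + 1) <= e * n%:R.
Proof.
move=> C0 e0; exists (Num.truncn (4 * C ^+ 2 / e ^+ 2)).+1 => n q Nn qn.
have nC : 4 * C ^+ 2 <= e ^+ 2 * n%:R.
  rewrite [X in _ <= X]mulrC -ler_pdivrMr ?exprn_gt0//.
  by apply/ltW; apply: lt_le_trans (truncnS_gt _) _; rewrite ler_nat.
have n1 : 1 <= n%:R :> R by rewrite ler1n (leq_trans _ Nn).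
have qn' : q%:R * q%:R <= n%:R :> R by rewrite -natrM ler_nat.
rewrite -(@ler_pXn2r _ 2)// ?nnegrE ?mulr_ge0 ?addr_ge0 ?ler0n//; last exact: ltW.
rewrite !exprMn; apply: (@le_trans _ _ (C ^+ 2 * (4 * n%:R))).
  rewrite ler_wpM2l ?sqr_ge0//; have := ler0n R q => q0.
  have : 0 <= (q%:R - 1) ^+ 2 :> R by exact: sqr_ge0.
  rewrite !expr2; lra.
by rewrite mulrA (mulrC _ 4) expr2 (mulrA _ n%:R) ler_wpM2r// ler0n.
Qed.

Lemma exponent_phase p (a : R) :
  (forall n, phase n = p -> slope n = a) ->
  exponent (phase_start p.+1) - exponent (phase_start p) =
    a * ((phase_start p.+1)%:R - (phase_start p)%:R).
Proof.
move=> pa.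
have pp : (phase_start p <= phase_start p.+1)%N.
  by rewrite phase_startS leq_pmulr// expn_gt0.
rewrite -natrB// /exponent -!(big_mkord xpredT slope).
rewrite (@big_cat_nat _ _ _ (phase_start p) 0 (phase_start p.+1))//= (addrC (bigop _ _ _)) addrK.
rewrite big_nat (eq_bigr (fun=> a)) => [|j jp]; last by rewrite pa// (phase_eq jp).
by rewrite -big_nat sumr_const_nat mulr_natr.
Qed.

Lemma exponent_low p : ~~ odd p ->
  exponent (phase_start p.+1) <=
    dlow * (phase_start p.+1)%:R + d%:R * (phase_start p)%:R.
Proof.
move=> pe; have : exponent (phase_start p.+1) - exponent (phase_start p) =
    dlow * ((phase_start p.+1)%:R - (phase_start p)%:R).
  by apply: exponent_phase => n np; rewrite /slope /low_level np pe.
have /andP[_] := exponent_bounds (phase_start p).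
have : 0 <= dlow * (phase_start p)%:R by rewrite mulr_ge0.
have : dup * (phase_start p)%:R <= d%:R * (phase_start p)%:R by rewrite ler_wpM2r.
lra.
Qed.

Lemma exponent_high p : odd p ->
  dup * (phase_start p.+1)%:R - d%:R * (phase_start p)%:R <=
    exponent (phase_start p.+1).
Proof.
move=> po; have : exponent (phase_start p.+1) - exponent (phase_start p) =
    dup * ((phase_start p.+1)%:R - (phase_start p)%:R).
  by apply: exponent_phase => n np; rewrite /slope /low_level np po.
have := exponent_ge0 (phase_start p).
have : dup * (phase_start p)%:R <= d%:R * (phase_start p)%:R by rewrite ler_wpM2r.
lra.
Qed.

Lemma fair_total_eventually_ge (a c : R) : 0 <= a -> a < dlow -> 0 <= c ->
  exists N, forall n, (N <= n)%N -> a * n.+1%:R + c <= (fair_total n)%:R.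
Proof.
move=> a0 al c0.
have [N HN] := @sqrt_negligible (1 + a + c) (dlow - a) ltac:(lra) ltac:(lra).
exists N => n Nn; have := HN n 0%N Nn isT; rewrite add0r mulr1.
have /andP[h1 _] := exponent_bounds n; have /andP[h2 _] := fair_total_bounds n.
rewrite -natr1; lra.
Qed.

Lemma fair_slab_total_eventually_le (k : nat) (b : R) : dup < b ->
  exists N, forall n, (N <= n)%N ->
    (fair_total n.+1 + k * slab_total n.+1)%:R <= b * n%:R.
Proof.
move=> db; have dup0 : 0 <= dup by apply: le_trans dlow_dup.
have k0 := ler0n R k.
have [N HN] := @sqrt_negligible (dup + k%:R) (b - dup) ltac:(lra) ltac:(lra).
exists N => n Nn; have := HN n _ Nn (slab_total_sqr n).
have /andP[_ h1] := exponent_bounds n.+1; have /andP[_ h2] := fair_total_bounds n.+1.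
have : (slab_total n.+1)%:R <= (slab_total n)%:R + 1 :> R.
  by rewrite natr1 ler_nat /slab_total big_ord_recr/= -addn1 leq_add2l leq_b1.
move=> /(ler_wpM2l k0).
have : 0 <= dup * (slab_total n)%:R by rewrite mulr_ge0.
rewrite natrD natrM; move: h1; rewrite -natr1; lra.
Qed.

Lemma fair_slab_total_often_le (k N : nat) (a : R) : dlow < a ->
  exists2 n, (N <= n)%N & (fair_total n + k * slab_total n)%:R + 1 <= a * n%:R.
Proof.
move=> la; have k0 := ler0n R k; have d0 := ler0n R d.
have [N1 H1] := @sqrt_negligible (d%:R + 1) ((a - dlow) / 2) ltac:(lra) ltac:(lra).
have [N2 H2] := @sqrt_negligible k%:R ((a - dlow) / 2) ltac:(lra) ltac:(lra).
pose p := (N + N1 + N2).*2; pose n := phase_start p.+1.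
have pn : (p < n)%N by rewrite (ltn_trans (ltnSn _))// ltnW// phase_start_gt.
exists n; first by move: pn; rewrite /p; lia.
have := H1 n (phase_start p) _ _; rewrite {2}/n phase_startS leqnn.
have := H2 n _ _ (slab_total_sqr n).
have /andP[_ h2] := fair_total_bounds n.
have := @exponent_low p; rewrite odd_double => /(_ isT); rewrite -/n => h3.
have Nn1 : (N1 <= n)%N by move: pn; rewrite /p; lia.
have Nn2 : (N2 <= n)%N by move: pn; rewrite /p; lia.
move=> /(_ Nn2) h4 /(_ Nn1 isT) h5.
have := ler0n R (phase_start p).
rewrite natrD natrM; lra.
Qed.

Lemma fair_total_often_ge (N : nat) (b c : R) : b < dup -> 0 <= c ->
  exists2 n, (N <= n)%N & b * n%:R + c <= (fair_total n)%:R.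
Proof.
move=> bd c0; have d0 := ler0n R d.
have [N1 H1] := @sqrt_negligible (d%:R + 1 + c) (dup - b) ltac:(lra) ltac:(lra).
pose p := (N + N1).*2.+1; pose n := phase_start p.+1.
have pn : (p < n)%N by rewrite (ltn_trans (ltnSn _))// ltnW// phase_start_gt.
exists n; first by move: pn; rewrite /p; lia.
have := H1 n (phase_start p) _ _; rewrite {2}/n phase_startS leqnn.
have /andP[h2 _] := fair_total_bounds n.
have := @exponent_high p; rewrite /= odd_double => /(_ isT); rewrite -/n => h3.
have Nn1 : (N1 <= n)%N by move: pn; rewrite /p; lia.
move=> /(_ Nn1 isT) h5.
have := mulr_ge0 c0 (ler0n R (phase_start p)); have := ler0n R (phase_start p).
lra.
Qed.

Hypothesis d_gt0 : (0 < d)%N.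
Hypothesis dlow_le : dlow <= d%:R - 1.

(** This is where [dlow <= d - 1] is used: in an even phase at most [d - 1] fair
    digits are needed, and coordinate 0 remains free for a slab. *)
Lemma fair_number_low n : low_level n -> (fair_number n < d)%N.
Proof.
move=> nl; rewrite -(prednK d_gt0) ltnS; apply: fair_number_le.
by rewrite /slope nl; apply: le_trans dlow_le _; rewrite -subn1 natrB.
Qed.

Lemma fair_not_slab m : fair_digit m -> ~~ slab_digit m.
Proof.
rewrite /fair_digit /slab_digit => h; apply/negP => /andP[/eqP m0 /andP[+ _]].
by move=> /fair_number_low; move: h; rewrite m0; lia.
Qed.

Lemma sum_by_levels (f : nat -> nat) n :
  (\sum_(m < n * d) f m = \sum_(j < n) \sum_(i < d) f (j * d + i))%N.
Proof.
elim: n => [|n IH]; first by rewrite !big_ord0.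
rewrite big_ord_recr/= -IH -!(big_mkord xpredT f) mulSn addnC.
rewrite (@big_cat_nat _ _ _ (n * d))//= ?leq_addr//; congr addn.
rewrite -{1}(add0n (n * d)%N) big_addn addKn big_mkord.
by apply: eq_bigr => i _; rewrite addnC.
Qed.

Lemma sum_fair_digit n : (\sum_(m < n * d) fair_digit m = fair_total n)%N.
Proof.
rewrite (sum_by_levels (fun m => fair_digit m : nat)); elim: n => [|n IH].
  by rewrite big_ord0 /fair_total /exponent big_ord0 truncn0.
rewrite big_ord_recr/= IH.
rewrite (eq_bigr (fun i : 'I_d => (d - fair_number n <= i)%N : nat)); last first.
  by move=> i _; rewrite /fair_digit divnMDl// divn_small// addn0 modnMDl modn_small.
have -> : (\sum_(i < d) (d - fair_number n <= i) = fair_number n)%N.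
  rewrite -(big_mkord xpredT (fun i => (d - fair_number n <= i)%N : nat)).
  rewrite (@big_cat_nat _ _ _ (d - fair_number n))//= ?leq_subr//.
  rewrite big_nat big1 ?add0n => [|i /andP[_ h]]; last by rewrite leqNgt h.
  rewrite big_nat (eq_bigr (fun=> 1%N)) => [|i /andP[h _]]; last by rewrite h.
  by rewrite -big_nat sum_nat_const_nat muln1 subKn// fair_number_le_d.
by rewrite subnKC// fair_total_mono.
Qed.

Lemma sum_slab_digit n : (\sum_(m < n * d) slab_digit m = slab_total n)%N.
Proof.
rewrite (sum_by_levels (fun m => slab_digit m : nat)); apply: eq_bigr => j _.
rewrite (bigD1 (Ordinal d_gt0))//= big1 ?addn0 => [|i].
  by rewrite /slab_digit modnMl mulnK.
rewrite -val_eqE/= /slab_digit modnMDl modn_small// => /negbTE->//.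
Qed.

End profile.

Lemma slab_digit_start d p : (0 < d)%N -> ~~ odd p -> slab_digit d ((phase_start p).+1 * d).
Proof.
move=> d_gt0 pe; rewrite /slab_digit modnMl mulnK//= /slab_level /low_level (@phase_eq p) ?pe ?eqxx//.
rewrite leqnSn phase_startS; have := phase_start_gt p; nia.
Qed.

(** The next phase starts at the square of the level of the slab, so that the slabs
    are thinner than the delta-th power of their distance, for every delta. *)
Lemma slab_radius (R : realType) (delta : R) p : 1 < delta -> 2 * delta + 4 <= (phase_start p)%:R ->
  let n := phase_start p.+1 in let j := (phase_start p).+1 in
  (j.+2 < n)%N /\ 2 * 2 ^- n < (2 ^- j.+1 + 2 ^- n) `^ delta :> R.
Proof.
move=> delta1 hY n j; have Y4 : (6 <= phase_start p)%N by rewrite -(ler_nat R); lra.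
have jn : (j.+2 < n)%N by rewrite /n phase_startS /j; nia.
split => //; apply: (@lt_le_trans _ _ ((2 ^- j.+1) `^ delta)); last first.
  apply: ge0_ler_powR; rewrite ?nnegrE ?addr_ge0 ?invr_ge0 ?exprn_ge0//; first lra.
  by rewrite lerDl invr_ge0 exprn_ge0.
rewrite powR_dyadic dyadicE -{1}(@powRr1 R 2)// -powRD; last first.
  by rewrite pnatr_eq0 implybT.
apply: ltr_powR2; rewrite /n phase_startS /j natrM -(natr1 (phase_start p).+1) -(natr1 (phase_start p)).
set Y := (phase_start p)%:R in hY *; have : 0 <= (Y - 2 * delta - 4) * (Y + 2) by apply: mulr_ge0; lra.
have : 0 <= Y * Y by apply: mulr_ge0; lra.
lra.
Qed.

Section slab_levels.
Context (R : realType) (d : nat) (dlow dup : R).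
Hypothesis d_gt0 : (0 < d)%N.
Hypothesis dlow_ge0 : 0 <= dlow.
Hypothesis dlow_le : dlow <= d%:R - 1.
Hypothesis dlow_dup : dlow <= dup.

Lemma quiet_level p l : ~~ odd p -> (phase_start p <= l < phase_start p.+1)%N ->
  l != (phase_start p).+1 ->
  ~~ slab_digit d (l * d) /\ ~~ fair_digit d dlow dup (l * d).
Proof.
move=> pe lp lj; have lph := phase_eq lp; split.
  by rewrite /slab_digit modnMl mulnK// /slab_level lph (negbTE lj) andbF.
rewrite /fair_digit modnMl mulnK// -ltnNge subn_gt0.
apply: fair_number_low => //.
by rewrite /low_level lph.
Qed.

End slab_levels.

(** * Regularity and completion *)

Section regularity.
Context (R : realType) (d : nat) (mu : probability (borel_rV R d) R).
Local Notation rV := 'rV[R]_d.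

Lemma measurable_open_rV (A : set (borel_rV R d)) :
  open (A : set rV) -> measurable A.
Proof. by move=> oA; exact: sub_sigma_algebra. Qed.

Lemma nonincreasing_measure_lt (F : (set (borel_rV R d))^nat) (e : R) :
  (forall n, measurable (F n)) -> nonincreasing_seq F ->
  (mu (\bigcap_n F n) < e%:E)%E -> exists n, (mu (F n) < e%:E)%E.
Proof.
move=> mF nF Fe; apply: contrapT => h.
have cF : mu \o F @ \oo --> mu (\bigcap_n F n).
  apply: nonincreasing_cvg_mu => //; last exact: bigcapT_measurable.
  by rewrite -ge0_fin_numE// fin_num_measure.
suff : (e%:E <= mu (\bigcap_n F n))%E by rewrite leNgt Fe.
apply: cvge_ge cF; apply: nearW => n; rewrite leNgt; apply/negP => Fn.
by apply: h; exists n.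
Qed.

Definition regular (A : set (borel_rV R d)) := forall e : R, 0 < e ->
  exists C V : set rV, [/\ closed C, open V, C `<=` A, A `<=` V &
    (mu (V `\` C) < e%:E)%E].

(** An open set is the increasing union of the closed sets of its points at
    distance at least [2 ^- n] from the complement. *)
Lemma regular_open (A : set rV) : open A -> regular A.
Proof.
move=> oA e e0.
pose B n : set rV := \bigcup_(y in ~` A) ball y (2 ^- n).
have oB n : open (B n) by apply: bigcup_open => y _; exact: ball_open.
pose F n : set (borel_rV R d) := A `&` B n.
have mF n : measurable (F n) by apply: measurable_open_rV; exact: openI.
have nF : nonincreasing_seq F.
  move=> m n mn; apply/subsetPset => x [Ax [y Ay yx]]; split => //.
  exists y => //; apply: le_ball yx.
  by rewrite lef_pV2 ?posrE ?exprn_gt0// ler_weXn2l// ler1n.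
have F0 : \bigcap_n F n = set0.
  apply/seteqP; split => // x Fx; have [Ax _] := Fx 0%N Logic.I.
  have := oA; rewrite openE => /(_ _ Ax) /nbhs_ballP[r /= r0 rA].
  have [n _ /(_ n (leqnn n))] := near_infty_natSinv_expn_lt (PosNum r0).
  rewrite div1r => nr; have [_ [y Ay yx]] := Fx n Logic.I.
  by apply: Ay; apply: rA; apply/ball_sym/(le_ball _ yx)/ltW.
have [|n Fn] := @nonincreasing_measure_lt F e mF nF.
  by rewrite F0 measure0 lte_fin.
exists (~` B n), A; split => //.
- exact: open_closedC.
- move=> x nBx; apply: contrapT => nAx; apply: nBx; exists x => //.
  by apply: ballxx; rewrite invr_gt0 exprn_gt0.
- by rewrite setDE setCK.
Qed.

Lemma regularC (A : set (borel_rV R d)) : regular A -> regular (~` A).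
Proof.
move=> rA e e0; have [C [V [cC oV CA AV VC]]] := rA e e0.
exists (~` V), (~` C); split.
- exact: open_closedC.
- exact: closed_openC.
- exact: subsetC.
- exact: subsetC.
- by rewrite setDE setCK setIC.
Qed.

Lemma regular_bigcup (A : (set (borel_rV R d))^nat) :
  (forall n, regular (A n)) -> regular (\bigcup_n A n).
Proof.
move=> rA e e0.
pose e_ n : R := (e / 2) / (2 ^ n.+1)%:R.
have e_gt0 n : 0 < e_ n by rewrite !divr_gt0// ltr0n expn_gt0.
have /choice[CV hCV] n : exists CV : set rV * set rV,
    [/\ closed CV.1, open CV.2, CV.1 `<=` A n, A n `<=` CV.2 &
    (mu (CV.2 `\` CV.1) < (e_ n)%:E)%E].
  by have [C [V ?]] := rA n (e_ n) (e_gt0 n); exists (C, V).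
pose C n := (CV n).1; pose V n := (CV n).2.
have cC n : closed (C n) by case: (hCV n).
have oV n : open (V n) by case: (hCV n).
(* a finite union of the [C j] is closed, and loses little mass for n large *)
pose F n : set (borel_rV R d) := \bigcup_j V j `\` \bigcup_(j in `I_n) C j.
have oVU : open (\bigcup_j V j) by exact: bigcup_open.
have cCn n : closed (\bigcup_(j in `I_n) C j : set rV).
  by apply: closed_bigcup => //; exact: finite_II.
have mVC n : measurable (V n `\` C n : set (borel_rV R d)).
  by apply: measurableD; [exact: measurable_open_rV|exact: measurable_closed_rV].
have mF n : measurable (F n).
  by apply: measurableD; [exact: measurable_open_rV|exact: measurable_closed_rV].
have nF : nonincreasing_seq F.
  move=> m n mn; apply/subsetPset => x [Vx nCx]; split => //.
  by move=> [j /= jm Cx]; apply: nCx; exists j => //=; exact: leq_trans mn.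
have Fe : (mu (\bigcap_n F n) < e%:E)%E.
  apply: (@le_lt_trans _ _ (e / 2)%:E); last by rewrite lte_fin; lra.
  apply: (@le_trans _ _ (\sum_(n <oo) mu (V n `\` C n))%E).
    apply: measure_sigma_subadditive => //; first exact: bigcapT_measurable.
    move=> x Fx; have [[j _ Vx] _] := Fx 0%N Logic.I; exists j => //; split => //.
    by move=> Cx; have [_] := Fx j.+1 Logic.I; apply; exists j => /=.
  apply: le_trans (epsilon_trick0 xpredT _); last by rewrite divr_ge0// ltW.
  by apply: lee_nneseries => // n _; apply/ltW; case: (hCV n).
have [n Fn] := nonincreasing_measure_lt mF nF Fe.
exists (\bigcup_(j in `I_n) C j), (\bigcup_j V j); split => //.
- by move=> x [j _ Cx]; exists j => //; case: (hCV j) => _ _ + _ _; apply.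
- by move=> x [j _ Ax]; exists j => //; case: (hCV j) => _ _ _ + _; apply.
Qed.

(** Regular sets form a sigma-algebra containing the open sets, by the three
    lemmas above. *)
Lemma regular_measurable (A : set (borel_rV R d)) : measurable A -> regular A.
Proof.
apply: smallest_sub; last exact: regular_open.
split.
- by apply: regular_open; exact: open0.
- by move=> B rB; rewrite setTD; exact: regularC.
- exact: regular_bigcup.
Qed.

Lemma radon_probability : radon mu.
Proof.
have closed_compact (K : set rV) : compact K -> closed K.
  by move=> cK; apply: compact_closed => //; exact: norm_hausdorff.
split=> [K cK|A mA].
  apply: le_lt_trans (probability_le1 _ _) _; last by rewrite ltry.
  apply: measurable_closed_rV. exact: closed_compact.
apply/eqP; rewrite eq_le; apply/andP; split; last first.
  apply: ge_ereal_sup => _ [K [cK KA] <-].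
  apply: le_measure; rewrite ?inE//.
  by apply: measurable_closed_rV; exact: closed_compact.
apply/lee_addgt0Pr => e e0.
have e20 : 0 < e / 2 by rewrite divr_gt0.
have [C [V [cC oV CA AV VC]]] := regular_measurable mA e20.
pose B n : set rV := cball 0 n%:R.
pose F n : set (borel_rV R d) := C `\` B n.
have mC : measurable (C : set (borel_rV R d)) by exact: measurable_closed_rV.
have mB n : measurable (B n : set (borel_rV R d)).
  by apply: measurable_closed_rV; exact: closed_cball.
have mF n : measurable (F n) by exact: measurableD.
have nF : nonincreasing_seq F.
  move=> m n mn; apply/subsetPset => x [Cx nBx]; split => // Bx; apply: nBx.
  by apply: le_trans Bx _; rewrite ler_nat.
have F0 : \bigcap_n F n = set0.
  apply/seteqP; split => // x Fx; have [_] := Fx (Num.truncn `|x|).+1 Logic.I; apply.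
  by rewrite /B /cball /closed_ball_/= sub0r normrN ltW// truncnS_gt.
have [|n Fn] := @nonincreasing_measure_lt F (e / 2) mF nF.
  by rewrite F0 measure0 lte_fin.
have cK : compact (C `&` B n).
  apply: bounded_closed_compact; last first.
    by apply: closedI => //; exact: closed_cball.
  exists n%:R; split; first exact: num_real.
  by move=> M nM x [_]; rewrite /B /cball /closed_ball_/= sub0r normrN => /le_trans; apply; exact: ltW.
apply: (@le_trans _ _ (mu (C `&` B n) + e%:E)%E); last first.
  apply: leeD => //; apply: ereal_sup_ubound; exists (C `&` B n) => //.
  by split => // x [/CA].
have mV : measurable (V : set (borel_rV R d)) by exact: measurable_open_rV.
apply: (@le_trans _ _ (mu ((C `&` B n) `|` (F n `|` (V `\` C))))%E).
  apply: le_measure; rewrite ?inE//.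
    by apply: measurableU; [exact: measurableI|apply: measurableU => //; exact: measurableD].
  move=> x /AV Vx; have [Cx|nCx] := pselect (C x); last by right; right.
  by have [Bx|nBx] := pselect (B n x); [left|right; left].
apply: le_trans (measureU2 _ _ _) _; [exact: measurableI| |].
  by apply: measurableU => //; exact: measurableD.
apply: leeD => //; apply: le_trans (measureU2 _ _ _) _ => //; first exact: measurableD.
by rewrite [e]splitr EFinD; apply: leeD; exact: ltW.
Qed.

Lemma completed_measure1 (B E : set (borel_rV R d)) :
  measurable B -> mu B = 1%E -> B `<=` E ->
  (mu^*)%mu.-cara.-measurable E /\
  @completed_measure_extension _ _ _ mu E = 1%E.
Proof.
move=> mB B1 BE.
have null : (mu^* (~` E))%mu = 0%E.
  apply/eqP; rewrite eq_le mu_ext_ge0// andbT.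
  apply: le_trans (le_mu_ext mu (subsetC BE)) _.
  have mCB : measurable (~` B) by exact: measurableC.
  have -> : mu_ext mu (~` B) = mu (~` B) by exact: measurable_mu_extE.
  by rewrite probability_setC// B1 subee.
split.
  apply: le_caratheodory_measurable => X.
  apply: (@le_trans _ _ (mu_ext mu X + 0)%E); last by rewrite adde0.
  apply: leeD; first by apply: le_mu_ext; exact: subIsetl.
  by rewrite -null; apply: le_mu_ext; exact: subIsetr.
rewrite /completed_measure_extension; apply/eqP; rewrite eq_le; apply/andP; split.
  apply: le_trans (le_mu_ext mu (@subsetT _ E)) _.
  have -> : mu_ext mu setT = mu setT by exact: measurable_mu_extE.
  by rewrite probability_setT.
apply: le_trans (le_mu_ext mu BE).
have -> : mu_ext mu B = mu B by exact: measurable_mu_extE.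
by rewrite B1.
Qed.

End regularity.

(** * The measure *)

Section slab_cantor_measure.
Context (R : realType) (d : nat) (dlow dup : R) (k : nat).
Hypothesis d_gt0 : (0 < d)%N.
Hypothesis dlow_ge0 : 0 <= dlow.
Hypothesis dlow_le : dlow <= d%:R - 1.
Hypothesis dlow_dup : dlow <= dup.
Hypothesis dup_le : dup <= d%:R.
Hypothesis k_gt0 : (0 < k)%N.
Local Notation fair := (fair_digit d dlow dup).
Local Notation slab := (slab_digit d).

Definition slab_cantor_digit : nat -> measurableTypeR R -> bool :=
  digit k fair slab.
Local Notation D := slab_cantor_digit.
Local Notation P := (unif01 : probability (measurableTypeR R) R).

Let measurable_D m : measurable [set u | D m u].
Proof. exact: measurable_digit. Qed.

Let independent_D m (E : set (measurableTypeR R)) :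
  measurable E -> free_of_digit D m E ->
  P (E `&` [set u | D m u]) = ((digit_prob R k fair slab m)%:E * P E)%E.
Proof. exact: digit_independent. Qed.

Let idle_D m u : D m u -> slab m || fair m.
Proof. exact: digit_idle. Qed.

Let fair_not_slab_D m : fair m -> ~~ slab m.
Proof. exact: fair_not_slab. Qed.

Definition slab_cantor_map : measurableTypeR R -> borel_rV R d := point R d D.

Let measurable_map : measurable_fun setT slab_cantor_map.
Proof. exact: measurable_point. Qed.

HB.instance Definition _ :=
  isMeasurableFun.Build _ _ _ _ slab_cantor_map measurable_map.

Definition slab_cantor_measure : probability (borel_rV R d) R :=
  distribution P slab_cantor_map.
Local Notation mu := slab_cantor_measure.

(** A Borel set of full measure, every point of which has a cube of each level
    around it that the digits reach; this is all that the dimensions need. *)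
Definition slab_cantor_set : set (borel_rV R d) := \bigcap_n cubes D n setT.

Lemma measurable_slab_cantor_set : measurable slab_cantor_set.
Proof. by apply: bigcapT_measurable => n; exact: measurable_cubes. Qed.

Lemma slab_cantor_set1 : mu slab_cantor_set = 1%E.
Proof.
rewrite -(probability_setT P); congr (P _).
by apply/seteqP; split => // u _ n _; exists u => //; exact: point_in_cube.
Qed.

Lemma slab_cantor_ball_le (x : borel_rV R d) n : slab_cantor_set x ->
  (mu (cball x (2 ^- n)) <=
   (2 ^+ (3 * d) * 2 ^- fair_total dlow dup n)%:E)%E.
Proof.
move=> /(_ n Logic.I)[u _ ux].
have := ball_measure_le measurable_D independent_D fair_not_slab_D ux.
by rewrite sum_fair_digit.
Qed.

Lemma slab_cantor_ball_ge (x : borel_rV R d) n : slab_cantor_set x ->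
  ((2 ^- (fair_total dlow dup n + k * slab_total n)%N)%:E <=
   mu (cball x (2 ^- n)))%E.
Proof.
move=> /(_ n Logic.I)[u _ ux].
have := ball_measure_ge measurable_D independent_D fair_not_slab_D idle_D k_gt0 ux.
by rewrite big_split/= -big_distrr/= sum_slab_digit// sum_fair_digit.
Qed.

Lemma slab_cantor_lower_dim : lower_dim mu = dlow%:E.
Proof.
apply: (lower_dimE measurable_slab_cantor_set slab_cantor_set1
  slab_cantor_ball_le slab_cantor_ball_ge dlow_ge0).
- by move=> b b0 bl; exact: fair_total_eventually_ge.
- move=> b N lb.
  exact: (fair_slab_total_often_le dlow_ge0 dlow_dup dup_le).
Qed.

Lemma slab_cantor_upper_dim : upper_dim mu = dup%:E.
Proof.
apply: (upper_dimE measurable_slab_cantor_set slab_cantor_set1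
  slab_cantor_ball_le slab_cantor_ball_ge (le_trans dlow_ge0 dlow_dup)).
- move=> b db.
  exact: (fair_slab_total_eventually_le dlow_ge0 dlow_dup dup_le).
- move=> b N bd.
  exact: (fair_total_often_ge dlow_ge0 dlow_dup dup_le).
Qed.

(* Slabs occur in the even phases only, hence [t.*2]. *)
Local Notation start t := (phase_start t.*2).
Local Notation lvl t := (start t).+1.
Local Notation fin t := (phase_start t.*2.+1).

Let light t : set (borel_rV R d) :=
  cubes D (fin t) [set u | D (lvl t * d)%N u = false].

(** A Borel set of full measure contained in [Eset], which is what the completion
    requires. *)
Definition light_slab_limsup : set (borel_rV R d) :=
  \bigcap_N \bigcup_(t in [set t | (N <= t)%N]) light t.

Lemma measurable_light_slab_limsup : measurable light_slab_limsup.
Proof.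
apply: bigcapT_measurable => N; apply: bigcup_measurable => t _.
exact: measurable_cubes.
Qed.

Let start_gt t : (t < start t)%N.
Proof.
by apply: leq_ltn_trans (ltnW (phase_start_gt _)); rewrite -addnn leq_addr.
Qed.

Let slab_lvl t : slab (lvl t * d)%N.
Proof. by apply: slab_digit_start; rewrite ?odd_double. Qed.

Let lvl_inj : injective (fun t => (lvl t * d)%N).
Proof.
move=> s t /eqP; rewrite eqn_pmul2r// eqSS /phase_start => /eqP h.
by apply/double_inj/(@expnI 2)/(@expnI 2).
Qed.

Lemma light_slab_limsup1 : mu light_slab_limsup = 1%E.
Proof.
have mC : measurable (~` light_slab_limsup).
  exact: measurableC measurable_light_slab_limsup.
have nC : mu (~` light_slab_limsup) = 0%E.
  apply: (@measure_negligible _ _ _ P).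
    by rewrite -[X in measurable X]setTI; exact: measurable_map.
  apply: negligibleS (light_slab_infinitely_often measurable_D independent_D
    lvl_inj slab_lvl).
  apply: subsetC => u h N _; have [t Nt ut] := h N; exists t => //; exists u => //.
  exact: point_in_cube.
by rewrite -[light_slab_limsup]setCK probability_setC// nC sube0.
Qed.

Lemma light_slab_limsup_sub_Eset (eta delta : R) :
  0 <= eta <= 1 - 2 ^- k -> 1 < delta ->
  light_slab_limsup `<=` Eset mu delta eta.
Proof.
move=> eta01 delta1 x limsup_x.
(* from this phase on, the slabs are thin enough *)
pose T := Num.truncn (2 * delta + 4).
have /choice[t_ ht] n : exists t, (n + T.+1 <= t)%N /\ light t x.
  by have [t /= nt lt] := limsup_x (n + T.+1)%N Logic.I; exists t.
pose r_ n : R := 2 ^- (lvl (t_ n)).+1 + 2 ^- fin (t_ n).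
have t_ge n : (n <= t_ n)%N.
  by have [nt _] := ht n; rewrite (leq_trans _ nt)// leq_addr.
have delta_start n : 2 * delta + 4 <= (start (t_ n))%:R.
  have [nt _] := ht n; apply: (le_trans (ltW (truncnS_gt _))).
  rewrite ler_nat (leq_trans _ (ltnW (start_gt _)))// (leq_trans _ nt)//.
  exact: leq_addl.
have radius n := slab_radius delta1 (delta_start n).
have r_gt0 n : 0 < r_ n by rewrite addr_gt0// invr_gt0 exprn_gt0.
have r_le n : r_ n <= 2 ^- lvl (t_ n).
  have [jn _] := radius n.
  have -> : 2 ^- lvl (t_ n) = 2 ^- (lvl (t_ n)).+1 + 2 ^- (lvl (t_ n)).+1 :> R.
    by rewrite (exprS _ (lvl (t_ n))); field; apply: lt0r_neq0; rewrite exprn_gt0.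
  rewrite lerD2l lef_pV2 ?posrE ?exprn_gt0// ler_weXn2l// ?ler1n//.
  exact/ltnW/ltnW.
exists r_; split.
- move=> n; rewrite r_gt0 (le_lt_trans (r_le n))// invf_lt1 ?exprn_gt0//.
  by rewrite exprn_egt1// ltr1n.
- apply: (@squeeze_cvgr _ _ _ _ (fun=> 0) (fun n => 2 ^- n)).
  + apply: nearW => n; rewrite ltW//= (le_trans (r_le n))//.
    rewrite lef_pV2 ?posrE ?exprn_gt0// ler_weXn2l// ?ler1n//.
    by rewrite (leq_trans (t_ge n))// ltnW// ltnW// ltnS start_gt.
  + exact: cvg_cst.
  + rewrite (_ : (fun n => _) = fun n => (2^-1) ^+ n); last first.
      by apply/funext => n; rewrite exprVn.
    by apply: cvg_expr; rewrite ger0_norm ?invr_ge0// invf_lt1// ltr1n.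
- move=> n; have [_ [u lu ux]] := ht n; have [jn rd] := radius n.
  have quiet l v : (lvl (t_ n) <= l.+1)%N -> (l < fin (t_ n))%N ->
      l != lvl (t_ n) -> D (l * d)%N v = false.
    move=> jl ln lj; apply/negP => /idle_D.
    have [] := @quiet_level R d dlow dup d_gt0 dlow_ge0 dlow_le dlow_dup
      (t_ n).*2 l _ _ lj.
    - by rewrite odd_double.
    - by rewrite -ltnS jl.
    - by move=> /negbTE-> /negbTE->.
  exact: (@slab_annulus_charged _ _ _ P d D k fair slab measurable_D
    independent_D (Ordinal d_gt0) _ _ u x delta eta erefl (ltn0Sn _) jn
    (slab_lvl _) quiet lu ux rd eta01).
Qed.

End slab_cantor_measure.

(* [Eset mu delta eta] need not be a Borel set, so its measure is taken with
   respect to the completion of mu. *)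
Theorem theorem1p6 (R : realType) (d : nat) (dlow dup eta delta : R) :
  (2 <= d)%N ->
  0 <= dlow <= d%:R - 1 -> dlow <= dup <= d%:R ->
  0 < eta < 1 -> 1 < delta ->
  exists mu : probability (borel_rV R d) R,
    [/\ radon mu,
        lower_dim mu = dlow%:E,
        upper_dim mu = dup%:E,
        (mu^*)%mu.-cara.-measurable (Eset mu delta eta) &
        @completed_measure_extension _ _ _ mu (Eset mu delta eta) = 1%E].
Proof.
move=> d2 /andP[dlow0 dlowd] /andP[dld dupd] /andP[eta0 eta1] delta1.
have d0 : (0 < d)%N by exact: ltnW.
have [k k0 ek] : exists2 k, (0 < k)%N & eta <= 1 - 2 ^- k.
  have e1 : 0 < 1 - eta by lra.
  have [k _ /(_ k.+1 (leqnSn k))] := near_infty_natSinv_expn_lt (PosNum e1).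
  by rewrite div1r /= => h; exists k.+1 => //; lra.
have eta01 : 0 <= eta <= 1 - 2 ^- k by rewrite ltW.
pose mu := slab_cantor_measure d dlow dup k.
have [mE E1] := @completed_measure1 _ _ mu _ (Eset mu delta eta)
  (@measurable_light_slab_limsup R d dlow dup k)
  (light_slab_limsup1 dlow dup d0 k0)
  (light_slab_limsup_sub_Eset d0 dlow0 dlowd dld k0 eta01 delta1).
exists mu; split => //.
- exact: radon_probability.
- exact: slab_cantor_lower_dim.
- exact: slab_cantor_upper_dim.
Qed.
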